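(* Let $d\geq 2$ be an integer and let $G$ be a finite simple graph embedded in a surface of Euler characteristic $\varepsilon\leq 0$. If $$\Delta(G)\geq \frac{d}{2d-1}\left(10d-8+\sqrt{(10d-2)^2-24(2d-1)\varepsilon}\right)+1,$$ then $C_{d,1}^T(G)\leq \Delta(G)+2d$.
   Context: $\Delta(G)$ is the maximum degree of $G$. A $(d,1)$-total labelling of $G$ is an assignment $c$ of integer labels (colors) to the elements of $V(G)\cup E(G)$ such that $c(u)\neq c(v)$ whenever $uv\in E(G)$, $c(e)\neq c(e')$ whenever $e,e'$ are distinct edges sharing an endpoint, and $|c(u)-c(e)|\geq d$ whenever vertex $u$ is incident with edge $e$. Given a list $L(x)$ of integers for each $x\in V(G)\cup E(G)$, an $L$-$(d,1)$-total labelling is a $(d,1)$-total labelling $c$ with $c(x)\in L(x)$ for all $x$. $G$ is $k$-$(d,1)$-total choosable if it has an $L$-$(d,1)$-total labelling for every list assignment $L$ with $|L(x)|=k$ for all $x\in V(G)\cup E(G)$. The $(d,1)$-total choosability $C_{d,1}^T(G)$ is the minimum $k$ such that $G$ is $k$-$(d,1)$-total choosable. *)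

(* Defs.v *)
From HB Require Import structures.
From mathcomp Require Import all_boot all_order all_algebra.
From mathcomp Require Import finmap boolp zify.

Set Implicit Arguments.
Unset Strict Implicit.
Unset Printing Implicit Defensive.

Import Order.TTheory GRing.Theory Num.Theory.
Local Open Scope ring_scope.

Record sgraph := SGraph {
  svertex :> finType;
  adj : rel svertex;
  adj_sym : symmetric adj;
  adj_irr : irreflexive adj }.

Definition degree (G : sgraph) (u : G) : nat := #|[set v | adj u v]|.

Definition max_degree (G : sgraph) : nat := (\max_(u : G) degree u)%N.

Definition edge_set (G : sgraph) : {set {set G}} :=
  [set [set p.1; p.2] | p : G * G & adj p.1 p.2].

Definition sedge (G : sgraph) := {e : {set G} | e \in edge_set G}.

Definition element (G : sgraph) := (G + sedge G)%type.

Definition total_labelling (d : nat) (G : sgraph) (c : element G -> int) :=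
  [/\ forall u v : G, adj u v -> c (inl u) <> c (inl v),
      forall (e f : sedge G) (w : G), e <> f -> w \in val e -> w \in val f ->
        c (inr e) <> c (inr f)
    & forall (u : G) (e : sedge G), u \in val e ->
        d%:Z <= `|c (inl u) - c (inr e)|].

Definition list_total_labelling (d : nat) (G : sgraph)
    (L : element G -> {fset int}) (c : element G -> int) :=
  total_labelling d c /\ forall x, c x \in L x.

Definition total_choosable (d k : nat) (G : sgraph) :=
  forall L : element G -> {fset int}, (forall x, #|` L x|%fset = k) ->
  exists c : element G -> int, list_total_labelling d L c.

(* Greedy choice: some k works, so the minimum defining the choosability      *)
(* exists.                                                                    *)
Lemma greedy_labelling (X : finType) (D k : nat) (L : X -> {fset int}) :
  (forall x, #|` L x|%fset = k) -> (#|X| * D.*2 < k)%N ->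
  exists c : X -> int, (forall x, c x \in L x) /\
    forall x y, x <> y -> D%:Z <= `|c x - c y|.
Proof.
move=> Lk ltk.
suff [c cL cD] : exists2 c : X -> int, {in enum X, forall x, c x \in L x} &
    {in enum X &, forall x y, x <> y -> D%:Z <= `|c x - c y|}.
  by exists c; split=> [x|x y]; [apply: cL | apply: cD]; rewrite mem_enum.
have : (size (enum X) * D.*2 < k)%N by rewrite -cardE.
elim: (enum X) => [|x s IHs] /= ltsk; first by exists (fun=> 0).
have [|c cL cD] := IHs; first by lia.
case xs: (x \in s).
  have ins z : z \in x :: s -> z \in s by rewrite inE => /predU1P[->|].
  by exists c => [z /ins/cL | z y /ins zs /ins ys]; last exact: cD.
pose F : seq int := flatten [seq [seq c y - D%:Z + i%:Z | i <- iota 0 D.*2] | y <- s].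
have szF : size F = (size s * D.*2)%N.
  rewrite /F; elim: (s) => //= y t IHt.
  by rewrite size_cat size_map size_iota IHt mulSn.
have [/allP LF | /allPn[/= a aL aF]] := boolP (all (fun a : int => a \in F) (L x)).
  have := uniq_leq_size (fset_uniq (L x)) LF.
  by rewrite szF -[size _]/(#|` L x|%fset) Lk; lia.
have aD y : y \in s -> D%:Z <= `|a - c y|.
  move=> ys; rewrite leNgt; apply: contra aF => ltD.
  apply/flatten_mapP; exists y => //; apply/mapP.
  exists (absz (a - c y + D%:Z)); last by lia.
  by rewrite mem_iota; lia.
have nx y : y \in s -> (y == x) = false.
  by move=> ys; apply: contraFF xs => /eqP <-.
exists (fun y => if y == x then a else c y) => [y|y z].
  by rewrite inE => /predU1P[->|ys]; rewrite ?eqxx ?nx //; apply: cL.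
rewrite !inE => /predU1P[->|ys] /predU1P[->|zs] ne; rewrite ?eqxx ?nx //.
- exact: aD.
- by rewrite distrC; apply: aD.
- exact: cD.
Qed.

Lemma ex_total_choosable (d : nat) (G : sgraph) :
  exists k, `[< total_choosable d k G >].
Proof.
pose X : finType := (G + sedge G)%type.
exists (#|X| * d.+1.*2).+1; apply/asboolP => L Lk.
have [|c [cL cD]] := @greedy_labelling X d.+1 _ L Lk; first by [].
exists c; split=> //; split=> [u v uv|e f w nef _ _|u e _].
- have nuv : @inl G (sedge G) u <> inl v.
    by case=> euv; rewrite euv adj_irr in uv.
  by have := cD _ _ nuv; lia.
- have nef' : @inr G (sedge G) e <> inr f by case.
  by have := cD _ _ nef'; lia.
- have nue : @inl G (sedge G) u <> inr e by [].
  by have := cD _ _ nue; lia.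
Qed.

Definition total_choosability (d : nat) (G : sgraph) : nat :=
  ex_minn (ex_total_choosable d G).

(* A closed connected surface, orientable or not, presented by a finite cell  *)
(* decomposition. A flag is an incident (vertex, edge, face) corner, i.e. a   *)
(* triangle of the barycentric subdivision; [flip0], [flip1] and [flip2] go   *)
(* to the adjacent flag with another vertex, edge and face, respectively.     *)
(* The one-skeleton is a connected multigraph, with loops allowed; the        *)
(* fixed-point conditions exclude boundary and semi-edges, so that each edge  *)
(* carries exactly four flags.                                                *)
Record surface := Surface {
  flag :> finType;
  flip0 : flag -> flag;
  flip1 : flag -> flag;
  flip2 : flag -> flag;
  flip0K : involutive flip0;
  flip1K : involutive flip1;
  flip2K : involutive flip2;
  flip02C : forall x, flip0 (flip2 x) = flip2 (flip0 x);
  flip0_free : forall x, flip0 x != x;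
  flip1_free : forall x, flip1 x != x;
  flip2_free : forall x, flip2 x != x;
  flip02_free : forall x, flip0 (flip2 x) != x;
  flag_inhabited : (0 < #|flag|)%N;
  flag_connected : forall x y,
    connect [rel u v | [|| v == flip0 u, v == flip1 u | v == flip2 u]] x y }.

Definition orbits2 (T : finType) (f g : T -> T) : {set {set T}} :=
  equivalence_partition (connect [rel u v | (v == f u) || (v == g u)]) [set: T].

Definition cell_vertices (S : surface) := orbits2 (@flip1 S) (@flip2 S).
Definition cell_edges (S : surface) := orbits2 (@flip0 S) (@flip2 S).
Definition cell_faces (S : surface) := orbits2 (@flip0 S) (@flip1 S).

Definition euler_char (S : surface) : int :=
  #|cell_vertices S|%:Z - #|cell_edges S|%:Z + #|cell_faces S|%:Z.

(* G is drawn in S as a subgraph of the one-skeleton, which may have further  *)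
(* vertices and edges; thus the faces of G itself need not be discs and G     *)
(* need not be connected. Since G is simple and [phi] is injective, distinct  *)
(* edges of G are drawn along distinct edges of the decomposition.            *)
Definition embedding (G : sgraph) (S : surface) (phi : G -> {set S}) :=
  [/\ injective phi,
      forall u, phi u \in cell_vertices S
    & forall u v, adj u v -> exists2 x : S, x \in phi u & flip0 x \in phi v].

Definition embedded_in (G : sgraph) (S : surface) :=
  exists phi : G -> {set S}, embedding phi.

(* Main.v *)
(* Write M for the maximum degree, k for M + 2d and K for                     *)
(* floor((M - 1) / 2d) + 1. For fixed lists of size k let F be a minimal set  *)
(* of edges that cannot be labelled. Recolouring an edge and then its end of  *)
(* low degree shows that an edge with an end of degree at most K has degree   *)
(* sum at least M + 3, so all degrees are at least 3. Removing and recolouring*)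
(* all edges at a set X of vertices of degree at most j <= K, by a Galvin-type*)
(* theorem on list colouring the edges of a bipartite graph, shows that some  *)
(* neighbour y of X has at most deg y + j - M - 2 neighbours in X. Hence there*)
(* are at most j - 2 vertices of degree at most j per vertex of degree at     *)
(* least M + 3 - j, which pays for the degrees below 6, and if some degree is *)
(* at most K there are M + 2 - K vertices of degree above K. If instead all   *)
(* degrees exceed K, label the vertices first: greedy edge labelling fails    *)
(* only if some subgraph has all edge degree sums at least M + 4 - 2d. In both*)
(* cases the sum of deg - 6 is at least (M + 2 - K)(K - 5), which the         *)
(* hypothesis makes larger than -6 eps, against Euler's formula.              *)
(* Euler's inequality for a subgraph of the skeleton comes from linear        *)
(* algebra over F_2: the coboundary of the vertices off the subgraph is       *)
(* injective and orthogonal to that of the faces on the remaining edges.      *)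
Require Import Defs.
From mathcomp Require Import all_boot all_order all_algebra reals.
From mathcomp Require Import finmap boolp zify ring lra.

Set Implicit Arguments.
Unset Strict Implicit.
Unset Printing Implicit Defensive.

Import Order.TTheory GRing.Theory Num.Theory.

(** Discharging against Euler's formula. A vertex of degree at most K can be labelled after
    everything else: each incident edge costs it at most 2d labels and 2dK < M + 2d
    ([recolour_vertices]). In a minimal unlabellable edge set F, an edge at such a vertex therefore
    has its other end of degree close to M ([edge_reducible]), and every set of such vertices has a
    neighbour with few neighbours in the set ([alternator_reducible], by
    [bipartite_list_colouring]). If F has a vertex of degree at most K, this supplies enough large
    degrees ([low_card], [degree_sum_low]); otherwise a subgraph with large degree sums along edges
    does ([dense_core], [degree_sum_no_low]). Either way the sum of deg - 6 is at least (K - 5)(M +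
    2 - K).

    On the other hand [degree_sum], the bound e <= 3(n - eps) for a drawn simple graph with n
    vertices and e edges, caps this sum at -6 eps. It comes from n - e + r >= eps, with r the number
    of regions ([euler_regions]), and from regions having length at least 3 ([region_length]). By
    [degree_threshold] and [charge_threshold] the two estimates are incompatible. *)

(** * List colouring the edges of a bipartite graph *)

(* Rado's proof: in a family of minimal total size all sets are singletons,   *)
(* by submodularity of the size of unions.                                    *)
Lemma Hall (I T : finType) (A : I -> {set T}) :
  (forall J : {set I}, #|J| <= #|\bigcup_(i in J) A i|) ->
  exists2 f : I -> T, injective f & forall i, f i \in A i.
Proof.
have [n] := ubnP (\sum_i #|A i|).
elim: n => // n IHn in A * => ltn hall.
have A0 i : 0 < #|A i| by have := hall [set i]; rewrite cards1 big_set1.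
have [A1 | /forallPn[i]] := boolP [forall i, #|A i| <= 1].
  have /fin_all_exists[f fA] i : exists a, A i = [set a].
    by apply/cards1P; rewrite eqn_leq A0 (forallP A1).
  exists f => [i j fij|i]; last by rewrite fA set11.
  apply/eqP/negPn/negP => nij.
  have := hall [set i; j].
  by rewrite cards2 nij bigcup_setU !big_set1 !fA fij setUid cards1.
rewrite -ltnNge => /card_gt1P[a [b [aA bA nab]]].
pose A' c j := if j == i then A i :\ c else A j.
suff [c cA hall'] : exists2 c, c \in A i &
    forall J : {set I}, #|J| <= #|\bigcup_(j in J) A' c j|.
  have [|f finj fA] := IHn (A' c) _ hall'.
    rewrite (bigD1 i) //= in ltn; rewrite (bigD1 i) //= {1}/A' eqxx.
    rewrite (eq_bigr (fun j => #|A j|)); last by move=> j /negPf; rewrite /A' => ->.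
    by rewrite (cardsD1 c (A i)) cA in ltn; lia.
  exists f => // j; have := fA j; rewrite /A'; case: eqP => // ->.
  by case/setD1P.
(* A family violating the condition once c is removed from [A i] must contain i. *)
have bad c : ~ (forall J : {set I}, #|J| <= #|\bigcup_(j in J) A' c j|) ->
    exists J : {set I}, #|(\bigcup_(j in J :\ i) A j) :|: (A i :\ c)| <= #|J :\ i|.
  move=> nh; have [J] : exists J : {set I}, #|\bigcup_(j in J) A' c j| < #|J|.
    by apply/existsP; apply: contra_notT nh => /existsPn h J; rewrite leqNgt h.
  have U (J' : {set I}) : i \notin J' -> \bigcup_(j in J') A' c j = \bigcup_(j in J') A j.
    move=> iJ; apply: eq_bigr => j jJ; rewrite /A'; case: eqP => // ji.
    by rewrite -ji jJ in iJ.
  have [iJ|iJ] := boolP (i \in J); last by rewrite U // ltnNge hall.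
  rewrite (big_setD1 i) //= {1}/A' eqxx U ?setD11 // (cardsD1 i J) iJ => lt.
  by exists J; rewrite setUC; lia.
have [ha|] := pselect (forall J : {set I}, #|J| <= #|\bigcup_(j in J) A' a j|).
  by exists a.
move=> /bad[Ja lea].
have [hb|] := pselect (forall J : {set I}, #|J| <= #|\bigcup_(j in J) A' b j|).
  by exists b.
move=> /bad[Jb leb].
exfalso; set J1 := Ja :\ i in lea; set J2 := Jb :\ i in leb.
set X := _ :|: _ in lea; set Y := _ :|: _ in leb.
(* As a and b differ, X and Y together cover [A i], which gives the extra 1; with [leI],
   submodularity then contradicts [lea] and [leb]. *)
have leU : #|i |: (J1 :|: J2)| <= #|X :|: Y|.
  apply: leq_trans (hall _) (subset_leq_card _).
  apply/bigcupsP => j; rewrite !in_setU in_set1 => /orP[/eqP->|].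
    apply/subsetP => z zA; rewrite !inE zA.
    by have [->|] := eqVneq z a; rewrite ?nab ?orbT.
  case/orP=> jJ.
    apply: subset_trans (bigcup_sup j jJ) (subset_trans _ (subsetUl _ _)).
    exact: subsetUl.
  apply: subset_trans (bigcup_sup j jJ) (subset_trans _ (subsetUr _ _)).
  exact: subsetUl.
have leI : #|J1 :&: J2| <= #|X :&: Y|.
  apply: leq_trans (hall _) (subset_leq_card _).
  apply/bigcupsP => j /setIP[j1 j2]; rewrite subsetI; apply/andP; split.
    exact: subset_trans (bigcup_sup j j1) (subsetUl _ _).
  exact: subset_trans (bigcup_sup j j2) (subsetUl _ _).
rewrite cardsU1 !inE eqxx /= in leU.
have := cardsUI X Y; have := cardsUI J1 J2; lia.
Qed.

Lemma sum_card (I : finType) (P : pred I) : \sum_i (P i : nat) = #|[set i | P i]|.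
Proof.
by rewrite -sum1_card [RHS]big_mkcond; apply: eq_bigr => i _; rewrite inE; case: (P i).
Qed.

(** The weight D|J| leaving J falls into its neighbourhood, which receives only D per element; this
    is Hall's condition. *)
Lemma regular_transversal (I : finType) (a : I -> I -> nat) (D : nat) :
    0 < D -> (forall u, \sum_v a u v = D) -> (forall v, \sum_u a u v = D) ->
  exists2 f : I -> I, injective f & forall u, 0 < a u (f u).
Proof.
move=> D0 row col; have [|f finj fA] := @Hall I I (fun u => [set v | 0 < a u v]).
  move=> J; set N := \bigcup_(u in J) _.
  rewrite -(leq_pmul2r D0) -!sum_nat_const.
  have -> : \sum_(u in J) D = \sum_(u in J) \sum_v a u v.
    by apply: eq_bigr => u _; rewrite row.
  have -> : \sum_(v in N) D = \sum_(v in N) \sum_u a u v.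
    by apply: eq_bigr => v _; rewrite col.
  rewrite exchange_big /= (bigID (fun v => v \in N)) /=.
  rewrite [X in _ + X]big1 ?addn0 => [|v vN].
    apply: leq_sum => v _; rewrite [X in _ <= X](bigID (fun u => u \in J)) /=.
    exact: leq_addr.
  apply: big1 => u uJ; apply/eqP; rewrite -leqn0 leqNgt; apply: contra vN => auv.
  by apply/bigcupP; exists u; rewrite // inE.
by exists f => // u; have := fA u; rewrite inE.
Qed.

(** * Stable matchings and Galvin's method *)

Section BipartiteListColouring.

Variables T U : finType.
Implicit Types (E M N : {set T * U}) (e f : T * U) (p q : T * U -> nat).

Definition degl E x := #|[set e in E | e.1 == x]|.
Definition degr E y := #|[set e in E | e.2 == y]|.

Definition matching M :=
  {in M &, forall e f, e.1 = f.1 \/ e.2 = f.2 -> e = f}.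

(* Padding the vertices with loops makes the graph D-regular; a transversal   *)
(* of the closed neighbourhoods then cannot fix a vertex of degree D.         *)
Lemma max_degree_matching E D :
    0 < D -> (forall x, degl E x <= D) -> (forall y, degr E y <= D) ->
  exists M, [/\ M \subset E, matching M,
    forall x, degl E x = D -> exists2 e, e \in M & e.1 = x
  & forall y, degr E y = D -> exists2 e, e \in M & e.2 = y].
Proof.
move=> D0 lD rD.
pose a (u v : T + U) : nat := match u, v with
  | inl x, inr y => (x, y) \in E | inr y, inl x => (x, y) \in E
  | inl x, inl x' => if x' == x then D - degl E x else 0
  | inr y, inr y' => if y' == y then D - degr E y else 0 end.
have row u : \sum_v a u v = D.
  rewrite big_sumType /=; case: u => [x|y] /=.
    rewrite -big_mkcond big_pred1_eq -[RHS](subnK (lD x)); congr addn.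
    rewrite sum_card /degl.
    have -> : [set e in E | e.1 == x] = [set (x, y) | y in [set y | (x, y) \in E]].
      apply/setP => -[x' y]; rewrite !inE /=; apply/andP/imsetP.
        by case=> xE /eqP ex; exists y; rewrite ?inE -ex.
      by case=> y'; rewrite inE => xE [-> ->].
    by rewrite card_imset // => y y' [].
  rewrite addnC -big_mkcond big_pred1_eq -[RHS](subnK (rD y)); congr addn.
  rewrite sum_card /degr.
  have -> : [set e in E | e.2 == y] = [set (x, y) | x in [set x | (x, y) \in E]].
    apply/setP => -[x y']; rewrite !inE /=; apply/andP/imsetP.
      by case=> xE /eqP ex; exists x; rewrite ?inE -ex.
    by case=> x'; rewrite inE => xE [-> ->].
  by rewrite card_imset // => x x' [].
have sym u v : a u v = a v u.
  by case: u v => [x|y] [x'|y'] //=; rewrite eq_sym; case: eqP => // ->.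
have [|f finj fa] := regular_transversal D0 row.
  by move=> v; rewrite -[RHS](row v); apply: eq_bigr => u _.
exists [set e in E | f (inl e.1) == inr e.2]; split.
- by apply/subsetP => e; rewrite inE => /andP[].
- move=> [x y] [x' y']; rewrite !inE /= => /andP[_ /eqP fe] /andP[_ /eqP fe'].
  case=> [exx|eyy]; first by move: fe fe'; rewrite exx => -> [->].
  by move: fe; rewrite eyy -fe' => /finj[->].
- move=> x dx; have := fa (inl x); case fx: (f (inl x)) => [x'|y] /=.
    by case: eqP => //; rewrite dx subnn.
  by case xyE: (_ \in E) => // _; exists (x, y); rewrite ?inE /= ?xyE ?fx ?eqxx.
move=> y dy; have [g _ gK] := injF_bij finj.
have := fa (g (inr y)); rewrite gK; case gy: (g (inr y)) => [x|y'] /=.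
  by case xyE: (_ \in E) => // _; exists (x, y); rewrite ?inE /= ?xyE -?gy ?gK ?eqxx.
by case: eqP => // <-; rewrite dy subnn.
Qed.

(** Strict rankings of the edges at each left end (by p) and at each right end (by q); smaller
    values are preferred. *)
Definition preferences E p q :=
  {in E &, forall e f, (e.1 = f.1 /\ p e = p f) \/ (e.2 = f.2 /\ q e = q f) -> e = f}.

Definition better_l E p e := [set f in E | (f.1 == e.1) && (p f < p e)].
Definition better_r E q e := [set f in E | (f.2 == e.2) && (q f < q e)].

Lemma matchingW M N : N \subset M -> matching M -> matching N.
Proof. by move=> /subsetP NM mM e f /NM eM /NM fM; apply: mM. Qed.

Lemma degl_sub E M x : M \subset E -> degl M x <= degl E x.
Proof. by move=> ME; rewrite subset_leq_card // !setIdE setSI. Qed.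

Lemma degr_sub E M x : M \subset E -> degr M x <= degr E x.
Proof. by move=> ME; rewrite subset_leq_card // !setIdE setSI. Qed.

Lemma degl_D E M x e : M \subset E -> e \in M -> e.1 = x ->
  degl (E :\: M) x < degl E x.
Proof.
move=> /subsetP ME eM ex; apply/proper_card/properP; split.
  by apply/subsetP => f; rewrite !inE -andbA => /and3P[_ -> ->].
by exists e; rewrite !inE ?eM ?ME // ex eqxx.
Qed.

Lemma degr_D E M y e : M \subset E -> e \in M -> e.2 = y ->
  degr (E :\: M) y < degr E y.
Proof.
move=> /subsetP ME eM ex; apply/proper_card/properP; split.
  by apply/subsetP => f; rewrite !inE -andbA => /and3P[_ -> ->].
by exists e; rewrite !inE ?eM ?ME // ex eqxx.
Qed.

Lemma better_l_lt E p e : e \in E -> #|better_l E p e| < degl E e.1.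
Proof.
move=> eE; apply/proper_card/properP; split.
  by apply/subsetP => f; rewrite !inE => /and3P[-> -> _].
by exists e; rewrite !inE eE eqxx // ltnn.
Qed.

Lemma better_r_lt E q e : e \in E -> #|better_r E q e| < degr E e.2.
Proof.
move=> eE; apply/proper_card/properP; split.
  by apply/subsetP => f; rewrite !inE => /and3P[-> -> _].
by exists e; rewrite !inE eE eqxx // ltnn.
Qed.

(* A matching saturating the vertices of maximum degree is put first at its   *)
(* left ends and last at its right ends.                                      *)
Lemma uniform_preferences E D :
    (forall x, degl E x <= D) -> (forall y, degr E y <= D) ->
  exists p q, preferences E p q /\
    {in E, forall e, #|better_l E p e| + #|better_r E q e| < D}.
Proof.
elim: D => [|D IHD] in E * => lD rD.
  have E0 e : e \in E -> False by move=> /(better_l_lt (fun=> 0)); rewrite ltnNge (leq_trans (lD _)).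
  by exists (fun=> 0), (fun=> 0); split=> e => [f|] /E0.
have [M [ME mM Ml Mr]] := max_degree_matching (ltn0Sn D) lD rD.
have [||p [q [pq lt]]] := IHD (E :\: M).
- move=> x; have := lD x; rewrite leq_eqVlt => /predU1P[/Ml[e eM ex]|].
    by have := degl_D ME eM ex; have := lD x; lia.
  by have := degl_sub x (subsetDl E M); lia.
- move=> x; have := rD x; rewrite leq_eqVlt => /predU1P[/Mr[e eM ex]|].
    by have := degr_D ME eM ex; have := rD x; lia.
  by have := degr_sub x (subsetDl E M); lia.
pose B := (\max_e q e).+1.
have qB e : q e < B by rewrite ltnS leq_bigmax.
pose p' e := if e \in M then 0 else (p e).+1.
pose q' e := if e \in M then B else q e.
exists p', q'; split.
  move=> e f eE fE; rewrite /p' /q'.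
  case eM: (e \in M); case fM: (f \in M) => h.
  - by apply: mM => //; case: h => -[]; auto.
  - by case: h => -[] // _; have := qB f; lia.
  - by case: h => -[] // _; have := qB e; lia.
  - by apply: pq; rewrite ?inE ?eM ?fM //; case: h => -[? ?]; [left|right]; split=> //; lia.
move=> e eE; have [eM|eM] := boolP (e \in M).
  rewrite (_ : better_l _ _ _ = set0); last first.
    by apply/setP => f; rewrite !inE /p' eM ltn0 !andbF.
  by rewrite cards0 add0n; have := better_r_lt q' eE; have := rD e.2; lia.
have lr : better_r E q' e \subset better_r (E :\: M) q e.
  apply/subsetP => f; rewrite !inE /q' (negPf eM); case: (f \in M) => //.
  by case/and3P=> _ _; have := qB e; lia.
(* M adds at most one better edge at the left end of e, and none at its right end. *)
have ll : #|better_l E p' e| <= #|better_l (E :\: M) p e| + 1.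
  have -> : better_l E p' e = better_l (E :\: M) p e :|: [set f in M | f.1 == e.1].
    apply/setP => f; rewrite !inE /p' (negPf eM).
    have [fM|fM] := boolP (f \in M); rewrite ?orbF //=.
    by rewrite (subsetP ME) // andbT.
  apply: leq_trans (leq_card_setU _ _) _; rewrite leq_add2l.
  rewrite leqNgt; apply/negP => /card_gt1P[f [g []]]; rewrite !inE.
  case/andP=> fM /eqP fe /andP[gM /eqP ge] /negP; apply; apply/eqP/mM => //.
  by left; rewrite fe ge.
have := lt e; rewrite inE eM eE => /(_ isT).
by have := subset_leq_card lr; lia.
Qed.

(* As long as some right end has degree above k, a matching saturating the    *)
(* right ends of maximum degree is put first there and last at its left ends. *)
Lemma skew_preferences E k D :
    (forall x, degl E x <= k) -> (forall y, degr E y <= D) ->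
  exists p q, preferences E p q /\
    {in E, forall e, #|better_l E p e| + #|better_r E q e| < maxn k (degr E e.2)}.
Proof.
move=> lk; elim: D => [|D IHD] in E lk * => rD.
  have [|p [q [pq lt]]] := @uniform_preferences E k lk.
    by move=> y; apply: leq_trans (rD y) _.
  by exists p, q; split=> // e /lt; lia.
have [kD|Dk] := leqP k D; last first.
  have [|p [q [pq lt]]] := @uniform_preferences E k lk.
    by move=> y; apply: leq_trans (rD y) _.
  by exists p, q; split=> // e /lt; lia.
have [|M0 [ME0 mM0 _ Mr0]] := max_degree_matching (ltn0Sn D) _ rD.
  by move=> x; apply: leq_trans (lk x) _; lia.
(* At a right end of degree at most k the bound has no room for another better edge, so the matching
   is kept only at right ends of degree D + 1 > k. *)
pose M := [set e in M0 | degr E e.2 == D.+1].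
have MM0 : M \subset M0 by apply/subsetP => e; rewrite inE => /andP[].
have ME := subset_trans MM0 ME0; have mM := matchingW MM0 mM0.
have dM e : e \in M -> degr E e.2 = D.+1 by rewrite inE => /andP[_ /eqP].
have Mr y : degr E y = D.+1 -> exists2 e, e \in M & e.2 = y.
  by move=> dy; have [e eM ey] := Mr0 y dy; exists e; rewrite // inE eM ey dy eqxx.
clearbody M.
have rD' y : degr (E :\: M) y <= D.
  have := rD y; rewrite leq_eqVlt => /predU1P[/Mr[e eM ex]|].
    by have := degr_D ME eM ex; have := rD y; lia.
  by have := degr_sub y (subsetDl E M); lia.
have [|//|p [q [pq lt]]] := IHD (E :\: M).
  by move=> x; apply: leq_trans (degl_sub x (subsetDl E M)) (lk x).
pose B := (\max_e p e).+1.
have pB e : p e < B by rewrite ltnS leq_bigmax.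
pose p' e := if e \in M then B else p e.
pose q' e := if e \in M then 0 else (q e).+1.
exists p', q'; split.
  move=> e f eE fE; rewrite /p' /q'.
  case eM: (e \in M); case fM: (f \in M) => h.
  - by apply: mM => //; case: h => -[]; auto.
  - by case: h => -[] // _; have := pB f; lia.
  - by case: h => -[] // _; have := pB e; lia.
  - by apply: pq; rewrite ?inE ?eM ?fM //; case: h => -[? ?]; [left|right]; split=> //; lia.
move=> e eE; have [eM|eM] := boolP (e \in M).
  rewrite (_ : better_r _ _ _ = set0); last first.
    by apply/setP => f; rewrite !inE /q' eM ltn0 !andbF.
  by rewrite cards0 addn0; have := better_l_lt p' eE; have := lk e.1; lia.
have ll : better_l E p' e \subset better_l (E :\: M) p e.
  apply/subsetP => f; rewrite !inE /p' (negPf eM); case: (f \in M) => //.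
  by case/and3P=> _ _; have := pB e; lia.
have -> : better_r E q' e = better_r (E :\: M) q e :|: [set f in M | f.2 == e.2].
  apply/setP => f; rewrite !inE /q' (negPf eM).
  have [fM|fM] := boolP (f \in M); rewrite ?orbF //=.
  by rewrite (subsetP ME) // andbT.
have := lt e; rewrite inE eM eE => /(_ isT).
have := subset_leq_card ll.
have [+ _] := leq_card_setU (better_r (E :\: M) q e) [set f in M | f.2 == e.2].
have := degr_sub e.2 (subsetDl E M); have := rD' e.2.
have [M0'|[f]] := set_0Vmem [set f in M | f.2 == e.2].
  by rewrite M0' cards0; lia.
rewrite inE => /andP[fM /eqP fe]; have := dM f fM; rewrite fe => ->.
suff : #|[set f in M | f.2 == e.2]| <= 1 by lia.
rewrite leqNgt; apply/negP => /card_gt1P[f' [g []]]; rewrite !inE.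
case/andP=> fM' /eqP fe' /andP[gM /eqP ge] /negP; apply; apply/eqP/mM => //.
by right; rewrite fe' ge.
Qed.

(** Gale and Shapley's theorem by deletion: if the favourites of two left ends clash at a right end,
    drop the one ranked lower there. The other, f, is the favourite at its left end, so a stable
    matching of the rest contains f or an edge beating f at that right end; it thus also dominates
    the dropped edge. *)
Lemma stable_matching E p q : preferences E p q ->
  exists M, [/\ M \subset E, matching M
  & forall e, e \in E :\: M -> exists2 f, f \in M &
      (f \in better_l E p e) || (f \in better_r E q e)].
Proof.
have [n] := ubnP #|E|; elim: n => // n IHn in E * => ltn pq.
pose B := [set e in E | better_l E p e == set0].
have BE : B \subset E by apply/subsetP => e; rewrite inE => /andP[].
have bestB e : e \in E :\: B -> exists2 f, f \in B & f \in better_l E p e.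
  rewrite !inE => /andP[+ eE]; rewrite eE /= => /set0Pn[f0 f0e].
  case: (@arg_minnP _ f0 (mem (better_l E p e)) p f0e) => f fe fmin.
  exists f => //; have /[!inE]/and3P[fE /eqP fe1 ltf] := fe.
  rewrite fE /=; apply/eqP/setP => g; rewrite !inE; apply/negP => /and3P[gE /eqP gf lg].
  have : g \in better_l E p e by rewrite !inE gE gf fe1 eqxx (ltn_trans lg).
  by move/fmin; lia.
have Bl : {in B &, forall e f, e.1 = f.1 -> e = f}.
  move=> e f; rewrite !inE => /andP[eE /eqP/setP eB] /andP[fE /eqP/setP fB] ef.
  apply: pq => //; left; split=> //.
  by have := eB f; have := fB e; rewrite !inE eE fE ef eqxx /=; lia.
have [/forall_inP h|] := boolP [forall e in B, forall f in B, (e.2 == f.2) ==> (e == f)].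
  exists B; split=> // [e f eB fB [|] ef|e /bestB[f fB fe]]; first exact: Bl.
    by apply/eqP; have /forall_inP/(_ f fB) := h e eB; rewrite ef eqxx.
  by exists f; rewrite // fe.
case/forall_inPn=> e eB /forall_inPn[f fB]; rewrite negb_imply => /andP[/eqP ef nef].
wlog lt : e f eB fB ef nef / q f < q e => [hw|].
  have := ltngtP (q f) (q e); case=> h; first exact: (hw e f).
    by apply: (hw f e); rewrite // eq_sym.
  by case/eqP: nef; apply: pq; rewrite ?(subsetP BE) //; right.
have eE := subsetP BE _ eB; have fE := subsetP BE _ fB.
have [||M [ME mM Md]] := IHn (E :\ e).
- by rewrite (cardsD1 e) eE in ltn; lia.
- by move=> g h /setD1P[_ gE] /setD1P[_ hE]; apply: pq.
have ME' := subset_trans ME (subD1set E e).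
exists M; split=> // g /setDP[gE gM].
have subl h : better_l (E :\ e) p h \subset better_l E p h.
  by apply/subsetP => z; rewrite !inE -andbA => /and3P[_ -> ->].
have subr h : better_r (E :\ e) q h \subset better_r E q h.
  by apply/subsetP => z; rewrite !inE -andbA => /and3P[_ -> ->].
have [ge|nge] := eqVneq g e; last first.
  have [|h hM hg] := Md g; first by rewrite !inE gM nge gE.
  exists h => //; case/orP: hg => [/(subsetP (subl _))->//|/(subsetP (subr _))->].
  by rewrite orbT.
have fe : f \in better_r E q e by rewrite !inE fE -ef eqxx.
rewrite ge; have [fM|fM] := boolP (f \in M); first by exists f; rewrite ?fe ?orbT.
have [|h hM] := Md f; first by rewrite !inE fM eq_sym nef.
case/orP=> [/(subsetP (subl _))|/(subsetP (subr _))].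
  by move: fB; rewrite inE => /andP[_ /eqP->]; rewrite inE.
rewrite inE => /and3P[hE /eqP hf lth]; exists h => //.
by rewrite !inE hE hf ef eqxx (ltn_trans lth) ?orbT.
Qed.

(** Galvin's argument: a label a goes to a stable matching of the edges listing a. Every other edge
    listing a loses a, but also loses a better edge, so the inequality persists. *)
Lemma preference_list_colouring E p q (L : T * U -> {fset int}) :
    preferences E p q ->
    {in E, forall e, #|better_l E p e| + #|better_r E q e| < #|` L e|%fset} ->
  exists c : T * U -> int, {in E, forall e, c e \in L e} /\
    {in E &, forall e f, e.1 = f.1 \/ e.2 = f.2 -> c e = c f -> e = f}.
Proof.
have [n] := ubnP #|E|; elim: n => // n IHn in E L * => ltn pq lt.
have [->|[e0 e0E]] := set_0Vmem E.
  by exists (fun=> 0%R); split=> e => [|f]; rewrite inE.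
have [a aL] : exists a, a \in L e0.
  by apply/fset0Pn; rewrite -cardfs_gt0 (leq_trans _ (lt _ e0E)).
pose Ea := [set e in E | a \in L e].
have EaE : Ea \subset E by apply/subsetP => e; rewrite inE => /andP[].
have [|M [MEa mM Md]] := @stable_matching Ea p q.
  by move=> e f /(subsetP EaE) eE /(subsetP EaE); apply: pq.
have ME := subset_trans MEa EaE.
have Mne : 0 < #|M|.
  have [e0M|e0M] := boolP (e0 \in M); first by apply/card_gt0P; exists e0.
  have [|f fM _] := Md e0; first by rewrite !inE e0M e0E.
  by apply/card_gt0P; exists f.
have [|||c [cL cP]] := IHn (E :\: M) (fun e => L e `\ a)%fset.
- by have := cardsID M E; rewrite (setIidPr ME); lia.
- by move=> e f /setDP[eE _] /setDP[fE _]; apply: pq.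
- move=> e /setDP[eE eM]; have := lt e eE.
  have subl : better_l (E :\: M) p e \subset better_l E p e.
    by apply/subsetP => z; rewrite !inE -andbA => /and3P[_ -> ->].
  have subr : better_r (E :\: M) q e \subset better_r E q e.
    by apply/subsetP => z; rewrite !inE -andbA => /and3P[_ -> ->].
  rewrite (cardfsD1 a (L e)); have [aLe|aLe] := boolP (a \in L e); last first.
    by move: (subset_leq_card subl) (subset_leq_card subr); clear; lia.
  have [|f fM] := Md e; first by rewrite !inE eM eE.
  case/orP=> fb.
    have : better_l (E :\: M) p e \proper better_l E p e.
      apply/properP; split=> //; exists f; last by rewrite !inE fM.
      by move: fb; rewrite !inE => /and3P[/andP[-> _] -> ->].
    by move/proper_card; move: (subset_leq_card subr); clear; lia.
  have : better_r (E :\: M) q e \proper better_r E q e.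
    apply/properP; split=> //; exists f; last by rewrite !inE fM.
    by move: fb; rewrite !inE => /and3P[/andP[-> _] -> ->].
  by move/proper_card; move: (subset_leq_card subl); clear; lia.
exists (fun e => if e \in M then a else c e); split=> [e eE|e f eE fE ef].
  case: ifP => eM; first by have := subsetP MEa e eM; rewrite inE => /andP[].
  by have := cL e; rewrite !inE eM eE => /(_ isT)/andP[].
case: ifP => eM; case: ifP => fM.
- by move=> _; apply: mM.
- by have := cL f; rewrite !inE fM fE => /(_ isT)/andP[/eqP na _] /esym.
- by have := cL e; rewrite !inE eM eE => /(_ isT)/andP[/eqP na _].
- by apply: cP; rewrite // inE ?eM ?fM.
Qed.

(** A weak form of the theorem of Borodin, Kostochka and Woodall, with a uniform bound k in place of
    the degree of the left end. *)
Lemma bipartite_list_colouring E k (L : T * U -> {fset int}) :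
    (forall x, degl E x <= k) ->
    {in E, forall e, maxn k (degr E e.2) <= #|` L e|%fset} ->
  exists c : T * U -> int, {in E, forall e, c e \in L e} /\
    {in E &, forall e f, e.1 = f.1 \/ e.2 = f.2 -> c e = c f -> e = f}.
Proof.
move=> lk Lk; have [|p [q [pq lt]]] := @skew_preferences E k (\max_y degr E y) lk.
  by move=> y; apply: leq_bigmax.
apply: preference_list_colouring pq _ => e eE.
exact: leq_trans (lt e eE) (Lk e eE).
Qed.

End BipartiteListColouring.

(** * Euler's inequality for subgraphs of the skeleton *)

Lemma even_card_involution (T : finType) (t : T -> T) (A : {set T}) :
    involutive t -> (forall x, t x != x) -> {in A, forall x, t x \in A} ->
  ~~ odd #|A|.
Proof.
move=> tK tfree; have [n] := ubnP #|A|; elim: n => // n IHn in A * => ltn tA.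
have [->|[x xA]] := set_0Vmem A; first by rewrite cards0.
have txA : t x \in A :\ x by rewrite !inE tfree tA.
rewrite (cardsD1 x) xA (cardsD1 (t x)) txA /= negbK.
apply: IHn => [|y]; first by rewrite (cardsD1 x) xA (cardsD1 (t x)) txA in ltn; lia.
rewrite !inE => /and3P[ytx yx yA]; rewrite (can_eq tK) yx tA // andbT.
by apply: contra ytx => /eqP <-; rewrite tK.
Qed.

Section Classes.

Variables (T : finType) (r : rel T).
Hypothesis r_sym : symmetric r.

(** The sets of cells of a surface unfold to [classes] of the relations of two flips, so the lemmas
    below apply to them by conversion. *)
Definition classes := equivalence_partition (connect r) [set: T].

Lemma classes_equiv : {in [set: T] & &, equivalence_rel (connect r)}.
Proof.
move=> x y z _ _ _; split; first exact: connect0.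
by move=> xy; apply: (same_connect (sym_connect_sym r_sym) xy).
Qed.

Lemma classes_partition : partition classes [set: T].
Proof. exact: equivalence_partitionP classes_equiv. Qed.

Lemma in_class A x y : A \in classes -> x \in A -> (y \in A) = connect r x y.
Proof.
case/and3P: classes_partition => _ tI _ AP xA.
by rewrite -(def_pblock tI AP xA) (pblock_equivalence_partition classes_equiv) ?inE.
Qed.

Lemma class_ex x : exists2 A, A \in classes & x \in A.
Proof.
case/and3P: classes_partition => /eqP cT tI _.
have xc : x \in cover classes by rewrite cT inE.
by exists (pblock classes x); [apply: pblock_mem | rewrite mem_pblock].
Qed.

Lemma class_inj A B x : A \in classes -> B \in classes -> x \in A -> x \in B -> A = B.
Proof. by move=> AP BP xA xB; apply/setP => y; rewrite (in_class y AP xA) (in_class y BP xB). Qed.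

Lemma class_rel A x y : A \in classes -> r x y -> (y \in A) = (x \in A).
Proof.
move=> AP rxy; apply/idP/idP => h; rewrite (in_class _ AP h) connect1 //.
by rewrite r_sym.
Qed.

Lemma class_n0 A : A \in classes -> exists x, x \in A.
Proof.
case/and3P: classes_partition => _ _ n0 AP; apply/set0Pn; apply: contraNneq n0 => <-.
by [].
Qed.

Lemma connect_const (X : Type) (h : T -> X) :
  (forall x y, r x y -> h y = h x) -> forall x y, connect r x y -> h y = h x.
Proof.
move=> hr x y /connectP[p + ->]; elim: p x => //= z p IHp x /andP[rxz pz].
by rewrite (IHp z) // (hr x z).
Qed.

End Classes.

Lemma orbit_rel_sym (T : finType) (f g : T -> T) : involutive f -> involutive g ->
  symmetric [rel u v | (v == f u) || (v == g u)].
Proof.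
move=> fK gK x y /=; congr orb; apply/eqP/eqP => ->; by rewrite ?fK ?gK.
Qed.

(** * Coboundaries over F_2 and regions of a drawn subgraph *)

Section SubgraphOfSkeleton.

(** N is the set of vertices of the drawn subgraph; [w] marks the flags on its edges. *)
Variables (S : surface) (N : {set {set S}}) (w : pred S).

Let s0 := @flip0 S.
Let s1 := @flip1 S.
Let s2 := @flip2 S.

Definition vertex_rel := [rel u v : S | (v == s1 u) || (v == s2 u)].
Definition edge_rel := [rel u v : S | (v == s0 u) || (v == s2 u)].
Definition face_rel := [rel u v : S | (v == s0 u) || (v == s1 u)].
Definition region_rel := [rel u v : S | [|| v == s0 u, v == s1 u | ~~ w u && (v == s2 u)]].

(* The faces of the drawn subgraph: the faces of S glued across the edges     *)
(* whose flags do not satisfy w.                                              *)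
Definition regions := classes region_rel.

Hypothesis N_sub : N \subset cell_vertices S.
Hypothesis N_n0 : N != set0.
Hypothesis w_flip0 : forall x, w (s0 x) = w x.
Hypothesis w_flip2 : forall x, w (s2 x) = w x.
Hypothesis w_ends : forall x v, w x -> v \in cell_vertices S -> x \in v -> v \in N.

Let s0K : involutive s0 := @flip0K S.
Let s1K : involutive s1 := @flip1K S.
Let s2K : involutive s2 := @flip2K S.
Let s02 x : s0 (s2 x) = s2 (s0 x) := flip02C x.

Lemma vertex_rel_sym : symmetric vertex_rel. Proof. exact: orbit_rel_sym s1K s2K. Qed.
Lemma edge_rel_sym : symmetric edge_rel. Proof. exact: orbit_rel_sym s0K s2K. Qed.
Lemma face_rel_sym : symmetric face_rel. Proof. exact: orbit_rel_sym s0K s1K. Qed.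
Lemma region_rel_sym : symmetric region_rel.
Proof.
move=> x y /=; congr [|| _, _ | _]; try by apply/eqP/eqP => ->; rewrite ?s0K ?s1K.
by apply/andP/andP => -[nw /eqP e]; rewrite e ?w_flip2 ?s2K; split=> //; move: nw;
  rewrite ?e ?w_flip2.
Qed.

Lemma in_v1 v x : v \in cell_vertices S -> (s1 x \in v) = (x \in v).
Proof. by move=> vV; apply: (class_rel vertex_rel_sym vV); rewrite /= eqxx. Qed.
Lemma in_v2 v x : v \in cell_vertices S -> (s2 x \in v) = (x \in v).
Proof. by move=> vV; apply: (class_rel vertex_rel_sym vV); rewrite /= eqxx orbT. Qed.
Lemma in_e0 v x : v \in cell_edges S -> (s0 x \in v) = (x \in v).
Proof. by move=> vV; apply: (class_rel edge_rel_sym vV); rewrite /= eqxx. Qed.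
Lemma in_e2 v x : v \in cell_edges S -> (s2 x \in v) = (x \in v).
Proof. by move=> vV; apply: (class_rel edge_rel_sym vV); rewrite /= eqxx orbT. Qed.
Lemma in_f0 v x : v \in cell_faces S -> (s0 x \in v) = (x \in v).
Proof. by move=> vV; apply: (class_rel face_rel_sym vV); rewrite /= eqxx. Qed.
Lemma in_f1 v x : v \in cell_faces S -> (s1 x \in v) = (x \in v).
Proof. by move=> vV; apply: (class_rel face_rel_sym vV); rewrite /= eqxx orbT. Qed.
Lemma in_r0 c x : c \in regions -> (s0 x \in c) = (x \in c).
Proof. by move=> cV; apply: (class_rel region_rel_sym cV); rewrite /= eqxx. Qed.
Lemma in_r1 c x : c \in regions -> (s1 x \in c) = (x \in c).
Proof. by move=> cV; apply: (class_rel region_rel_sym cV); rewrite /= eqxx orbT. Qed.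
Lemma in_r2 c x : c \in regions -> ~~ w x -> (s2 x \in c) = (x \in c).
Proof. by move=> cV wx; apply: (class_rel region_rel_sym cV); rewrite /= wx eqxx !orbT. Qed.

Lemma edgeE e x : e \in cell_edges S -> x \in e ->
  e = [set x; s0 x; s2 x; s0 (s2 x)].
Proof.
move=> eE xe; apply/setP => y; apply/idP/idP; last first.
  by rewrite !inE -!orbA => /or4P[] /eqP->; rewrite ?in_e0 ?in_e2.
rewrite (in_class edge_rel_sym y eE xe); set A := [set _; _; _; _].
have AP u v : edge_rel u v -> (v \in A) = (u \in A).
  have cl u' v' : edge_rel u' v' -> u' \in A -> v' \in A.
    rewrite !inE /= -!orbA => /orP[] /eqP->; case/or4P=> /eqP->;
      by rewrite ?s0K ?s2K -?s02 ?s0K ?s2K ?eqxx ?orbT.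
  by move=> uv; apply/idP/idP; apply: cl => //; apply: etrans (edge_rel_sym v u) uv.
by move/(connect_const AP)->; rewrite !inE eqxx.
Qed.

Lemma edge_sum (V : nmodType) (h : S -> V) e x : e \in cell_edges S -> x \in e ->
  (\sum_(z in e) h z = h x + h (s0 x) + h (s2 x) + h (s0 (s2 x)))%R.
Proof.
move=> eE xe; rewrite (edgeE eE xe).
have f0 := @flip0_free S x; have f2 := @flip2_free S x; have f02 := @flip02_free S x.
have g0 := @flip0_free S (s2 x).
have g2 : s2 x != s0 x.
  by apply: contra f02 => /eqP e2; rewrite -/s0 -/s2 e2 s0K.
have g02 : s0 (s2 x) != s0 x by rewrite (can_eq s0K).
rewrite setUC big_setU1 /=; last first.
  by rewrite !inE !negb_or /= f02 g02 g0.
rewrite setUC big_setU1 /=; last by rewrite !inE !negb_or g2 f2.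
rewrite setUC big_setU1 /=; last by rewrite !inE f0.
by rewrite big_set1 addrC [(_ + h x)%R]addrC [(h (s2 x) + _)%R]addrC.
Qed.

Lemma card_edge e : e \in cell_edges S -> #|e| = 4.
Proof.
move=> eE; have [x xe] := class_n0 edge_rel_sym eE.
by rewrite -sum1_card; apply: (edge_sum (fun=> 1%N) eE xe).
Qed.

Lemma incidence_even v f : v \in cell_vertices S -> f \in cell_faces S ->
  ~~ odd #|v :&: f|.
Proof.
move=> vV fF; apply: (even_card_involution s1K (@flip1_free S)) => x.
by rewrite !inE in_v1 // in_f1.
Qed.

Let x0 : S := sval (sigW (card_gt0P (flag_inhabited S))).

Definition rep (A : {set S}) : S := odflt x0 [pick x in A].

Lemma rep_class (r : rel S) A : symmetric r -> A \in classes r -> rep A \in A.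
Proof.
move=> rs AP; rewrite /rep; case: pickP => //= n; have [x] := class_n0 rs AP.
by rewrite n.
Qed.

Definition free_vertices := cell_vertices S :\: N.
Definition free_edges := [set e in cell_edges S | ~~ w (rep e)].
Definition used_edges := [set e in cell_edges S | w (rep e)].

(** Ends of an edge at a vertex, mod 2. Written as a difference, a kernel equation says that values
    at the two ends agree; [coboundary2] does this for the two sides. *)
Definition coboundary0 : 'M['F_2]_(#|free_vertices|, #|free_edges|) :=
  (\matrix_(i < #|free_vertices|, j < #|free_edges|)
    ((rep (enum_val j) \in (enum_val i : {set S}))%:R
     - (s0 (rep (enum_val j)) \in (enum_val i : {set S}))%:R))%R.
Definition coboundary2 : 'M['F_2]_(#|cell_faces S|, #|free_edges|) :=
  (\matrix_(i < #|cell_faces S|, j < #|free_edges|)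
    ((rep (enum_val j) \in (enum_val i : {set S}))%:R
     - (s2 (rep (enum_val j)) \in (enum_val i : {set S}))%:R))%R.

Lemma w_edge e x y : e \in cell_edges S -> x \in e -> y \in e -> w x = w y.
Proof.
move=> eE xe; rewrite (edgeE eE xe) !inE -!orbA.
by case/or4P=> /eqP->; rewrite ?w_flip0 ?w_flip2.
Qed.

(** Expanding gives one term per flag of e, as [flip2] keeps the vertex and [flip0] the face; signs
    vanish over F_2. *)
Lemma product_sum e v f : e \in cell_edges S -> v \in cell_vertices S ->
    f \in cell_faces S ->
  (((rep e \in v)%:R - (s0 (rep e) \in v)%:R) *
   ((rep e \in f)%:R - (s2 (rep e) \in f)%:R) =
   \sum_(z in e) (z \in v :&: f)%:R :> 'F_2)%R.
Proof.
move=> eE vV fF; have xe := rep_class edge_rel_sym eE.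
rewrite (edge_sum _ eE xe) !inE !(in_f0 _ fF) s02 !(in_v2 _ vV).
by case: (rep e \in v); case: (s0 _ \in v); case: (rep e \in f); case: (s2 _ \in f);
  apply/eqP.
Qed.

(* An entry counts the flags of S in a given vertex and a given face, which   *)
(* flip1 pairs up; the edges missing from the sum meet no vertex outside N.   *)
Lemma coboundary_orthogonal : (coboundary0 *m coboundary2^T = 0)%R.
Proof.
apply/matrixP => i j; rewrite !mxE.
set v := enum_val i; set f := enum_val j.
have /setDP[vV vN] : v \in free_vertices by apply: enum_valP.
have fF : f \in cell_faces S by apply: enum_valP.
transitivity (\sum_(e in cell_edges S) \sum_(z in e) (z \in v :&: f)%:R : 'F_2)%R.
  transitivity (\sum_(e in free_edges) ((rep e \in v)%:R - (s0 (rep e) \in v)%:R) *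
   ((rep e \in f)%:R - (s2 (rep e) \in f)%:R) : 'F_2)%R.
    by rewrite [RHS]big_enum_val; apply: eq_bigr => k _; rewrite !mxE.
  rewrite [RHS](bigID (fun e => w (rep e))) /= [X in (_ = X + _)%R]big1 ?add0r.
    rewrite [LHS](eq_bigl (fun e => (e \in cell_edges S) && ~~ w (rep e))).
      by apply: eq_bigr => e /andP[eE _]; apply: product_sum.
    by move=> e; rewrite inE.
  move=> e /andP[eE we]; rewrite -product_sum //.
  have nv x : w x -> x \in v = false.
    by move=> wx; apply: contraNF vN; apply: w_ends.
  by rewrite !nv ?w_flip0 // subrr mul0r.
rewrite -(set_partition_big _ (classes_partition edge_rel_sym)) /=.
rewrite (eq_bigl predT); last by move=> z; rewrite inE.
rewrite -natr_sum sum_card (_ : [set _ | _] = v :&: f); last by apply/setP => z; rewrite !inE.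
have := incidence_even vV fF; rewrite -dvdn2 => /dvdnP[k ->].
by rewrite natrM (_ : 2%:R = 0 :> 'F_2)%R ?mulr0 //; apply/eqP.
Qed.

Lemma class_sum (V : pzSemiRingType) (r : rel S) (P : {set {set S}})
    (u : 'I_#|P| -> V) (i : 'I_#|P|) x :
    symmetric r -> P \subset classes r -> x \in enum_val i ->
  (\sum_j u j * (x \in enum_val j)%:R = u i)%R.
Proof.
move=> rs /subsetP PC xi; rewrite (bigD1 i) //= xi mulr1 big1 ?addr0 // => j ji.
case xj: (_ \in _); rewrite ?mulr0 //; case/eqP: ji; apply: enum_val_inj.
by apply: (class_inj rs _ _ xj xi); apply: PC; apply: enum_valP.
Qed.

Lemma full_connect (V : Type) (h : S -> V) :
  (forall x, h (s0 x) = h x) -> (forall x, h (s1 x) = h x) ->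
  (forall x, h (s2 x) = h x) -> forall x y, h x = h y.
Proof.
move=> h0 h1 h2 x y; apply: connect_const (flag_connected y x) => u v /=.
by case/or3P=> /eqP->.
Qed.

(** A kernel vector is a function on vertices that vanishes on N and agrees at the ends of free
    edges. Used edges have both ends in N, so it is constant on the connected surface, hence
    zero. *)
Lemma coboundary0_free : row_free coboundary0.
Proof.
apply: inj_row_free => u u0.
pose h (x : S) : 'F_2 := (\sum_i u ord0 i * (x \in enum_val i)%:R)%R.
have vV (i : 'I_#|free_vertices|) : enum_val i \in cell_vertices S.
  by have /setDP[] : enum_val i \in free_vertices by apply: enum_valP.
have h1 x : h (s1 x) = h x by apply: eq_bigr => i _; rewrite in_v1.
have h2 x : h (s2 x) = h x by apply: eq_bigr => i _; rewrite in_v2.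
have hN x v : v \in N -> x \in v -> h x = 0%R.
  move=> vN xv; apply: big1 => i _; case xi: (_ \in _); rewrite ?mulr0 //.
  have /setDP[iV] : enum_val i \in free_vertices by apply: enum_valP.
  by rewrite (class_inj vertex_rel_sym iV (subsetP N_sub _ vN) xi xv) vN.
have h0 x : h (s0 x) = h x.
  have [e eE xe] := class_ex edge_rel_sym x.
  have [wx|wx] := boolP (w x).
    have [v vV' xv] := class_ex vertex_rel_sym x.
    have [v' vV'' xv'] := class_ex vertex_rel_sym (s0 x).
    rewrite (hN x v) // ?(w_ends _ vV' xv) //.
    by rewrite (hN _ v') // (w_ends _ vV'' xv') ?w_flip0.
  have re := rep_class edge_rel_sym eE.
  have eF : e \in free_edges by rewrite inE eE (w_edge eE re xe).
  have hr : h (s0 (rep e)) = h (rep e).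
    have := congr1 (fun M : 'rV_ _ => M ord0 (enum_rank_in eF e)) u0.
    rewrite !mxE; under eq_bigr do rewrite mxE enum_rankK_in //  mulrBr.
    by rewrite sumrB => /subr0_eq.
  move: xe; rewrite (edgeE eE re) !inE -!orbA.
  by case/or4P=> /eqP->; rewrite ?s02 ?h2 ?s0K ?hr // -s02 s0K ?h2 ?hr.
apply/matrixP => i j; rewrite ord1 mxE.
have [v vN] := set0Pn _ N_n0; have [y yv] := class_n0 vertex_rel_sym (subsetP N_sub v vN).
have xj := rep_class vertex_rel_sym (vV j).
rewrite -(class_sum (fun j => u ord0 j) vertex_rel_sym _ xj) ?subsetDl //.
by rewrite -/(h _) (full_connect h0 h1 h2 _ y) (hN y v).
Qed.

(** A kernel vector is a function on faces that agrees across free edges, hence a combination of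
    indicators of regions. *)
Lemma rank_coboundary2 : #|cell_faces S| <= \rank coboundary2 + #|regions|.
Proof.
pose P : 'M['F_2]_(#|regions|, #|cell_faces S|) :=
  (\matrix_(c < #|regions|, f < #|cell_faces S|)
    (rep (enum_val f) \in (enum_val c : {set S}))%:R)%R.
suff : \rank (kermx coboundary2) <= #|regions|.
  by rewrite mxrank_ker; have := rank_leq_row coboundary2; lia.
apply: leq_trans (mxrankS _) (rank_leq_row P).
apply/row_subP => k; set u := row k _.
have u0 : (u *m coboundary2 = 0)%R by apply/sub_kermxP; rewrite row_sub.
clearbody u.
pose h (x : S) : 'F_2 := (\sum_i u ord0 i * (x \in enum_val i)%:R)%R.
have h0 x : h (s0 x) = h x by apply: eq_bigr => i _; rewrite in_f0 // enum_valP.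
have h1 x : h (s1 x) = h x by apply: eq_bigr => i _; rewrite in_f1 // enum_valP.
have h2 x : ~~ w x -> h (s2 x) = h x.
  move=> wx; have [e eE xe] := class_ex edge_rel_sym x.
  have re := rep_class edge_rel_sym eE.
  have eF : e \in free_edges by rewrite inE eE (w_edge eE re xe).
  have hr : h (s2 (rep e)) = h (rep e).
    have := congr1 (fun M : 'rV_ _ => M ord0 (enum_rank_in eF e)) u0.
    rewrite !mxE; under eq_bigr do rewrite mxE enum_rankK_in //  mulrBr.
    by rewrite sumrB => /subr0_eq.
  move: xe; rewrite (edgeE eE re) !inE -!orbA.
  by case/or4P=> /eqP->; rewrite -?s02 ?h0 ?s2K ?hr // s02 s2K ?h0 ?hr.
have hc c x y : c \in regions -> x \in c -> y \in c -> h y = h x.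
  move=> cR xc; rewrite (in_class region_rel_sym y cR xc); apply: connect_const.
  by move=> a b /= /or3P[/eqP->|/eqP->|/andP[wa /eqP->]]; rewrite ?h0 ?h1 ?h2.
suff -> : u = ((\row_c h (rep (enum_val c))) *m P)%R by apply: submxMl.
apply/matrixP => i j; rewrite ord1 mxE.
have xj : rep (enum_val j) \in enum_val j.
  by apply: rep_class face_rel_sym _; apply: enum_valP.
have [c cR jc] := class_ex region_rel_sym (rep (enum_val j)).
transitivity (h (rep (enum_val j))).
  by rewrite /h (class_sum (fun j => u ord0 j) face_rel_sym _ xj).
under eq_bigr do rewrite !mxE.
have jc' : rep (enum_val j) \in enum_val (enum_rank_in cR c) by rewrite enum_rankK_in.
rewrite (class_sum (fun c => h (rep (enum_val c))) region_rel_sym _ jc') //.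
rewrite enum_rankK_in //; apply: hc jc; rewrite // (rep_class region_rel_sym) //.
Qed.

(** The ranks |V| - |N| and at least |F| - |regions| of two orthogonal matrices add up to at most
    the number of free edges. *)
Lemma euler_regions :
  #|cell_vertices S| + #|cell_faces S| + #|used_edges| <=
  #|cell_edges S| + #|N| + #|regions|.
Proof.
have := mulmx0_rank_max coboundary_orthogonal.
rewrite mxrank_tr (eqP coboundary0_free); have := rank_coboundary2.
have -> : #|cell_edges S| = #|used_edges| + #|free_edges|.
  rewrite -(cardsID [set e | w (rep e)]); congr (_ + _).
    by apply: eq_card => e; rewrite !inE.
  by apply: eq_card => e; rewrite !inE andbC.
by rewrite cardsD (setIidPr N_sub); have := subset_leq_card N_sub; lia.
Qed.

Lemma card_used_flags : #|[set x | w x]| = 4 * #|used_edges|.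
Proof.
rewrite -sum1_card (eq_bigl (fun x => (x \in [set: S]) && w x)); last first.
  by move=> x; rewrite !inE.
rewrite (set_partition_big_cond _ (classes_partition edge_rel_sym)) /=.
rewrite (bigID (fun e => w (rep e))) /= [X in _ + X]big1 ?addn0.
  rewrite mulnC -sum_nat_const; apply: eq_big => e; first by rewrite inE.
  case/andP=> eE we; rewrite -(card_edge eE) -sum1_card; apply: eq_bigl => x.
  case xe: (x \in e) => //=.
  by rewrite (w_edge eE xe (rep_class edge_rel_sym eE)).
move=> e /andP[eE we]; apply: big1 => x /andP[xe].
by rewrite (w_edge eE xe (rep_class edge_rel_sym eE)) (negPf we).
Qed.

(** * Lengths of regions and the edge bound *)

Hypothesis w_noloop : forall x v, w x -> v \in cell_vertices S -> x \in v ->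
  s0 x \notin v.
Hypothesis w_simple : forall x y v v', w x -> w y ->
  v \in cell_vertices S -> v' \in cell_vertices S -> x \in v -> y \in v ->
  s0 x \in v' -> s0 y \in v' -> y = x \/ y = s2 x.

(** [flip1] pairs the flags of c at v, and [flip2] pairs those off the drawn edges; an even number
    remains. *)
Lemma region_vertex_even c v : c \in regions -> v \in cell_vertices S ->
  ~~ odd #|[set x in c | w x] :&: v|.
Proof.
move=> cR vV.
have e1 : ~~ odd #|c :&: v|.
  apply: (even_card_involution s1K (@flip1_free S)) => x.
  by rewrite !inE (in_v1 _ vV) (in_r1 _ cR).
have e2 : ~~ odd #|(c :&: v) :\: [set x | w x]|.
  apply: (even_card_involution s2K (@flip2_free S)) => x.
  rewrite !inE (in_v2 _ vV) w_flip2 => /and3P[wx xc ->].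
  by rewrite wx (in_r2 cR) // xc.
rewrite -(cardsID [set x | w x]) oddD (negPf e2) addbF in e1.
by rewrite (_ : _ :&: v = (c :&: v) :&: [set x | w x]) //; apply/setP => x;
  rewrite !inE; case: (x \in c); case: (x \in v); case: (w x).
Qed.

Lemma region_full c x : c \in regions -> x \in c ->
  (forall z, z \in c -> w z -> s2 z \in c) -> forall y, y \in c.
Proof.
move=> cR xc c2 y.
have cc z : z \in c -> s2 z \in c.
  by move=> zc; have [wz|wz] := boolP (w z); [apply: c2 | rewrite in_r2].
rewrite (@full_connect _ (fun z => z \in c) _ _ _ y x) // => z.
- exact: in_r0.
- exact: in_r1.
- by apply/idP/idP => /cc //; rewrite s2K.
Qed.

Lemma even_other (A : {set S}) x : ~~ odd #|A| -> x \in A -> exists2 y, y \in A & y != x.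
Proof.
move=> evA xA; have : 0 < #|A :\ x| by rewrite (cardsD1 x) xA in evA; lia.
by case/card_gt0P=> y /setD1P[yx yA]; exists y.
Qed.

(* In a shorter region the parities at the vertices force a loop, a pair of   *)
(* parallel edges, or a single edge with this region on both of its sides.    *)
Lemma region_length c : c \in regions -> 1 < #|used_edges| ->
  6 <= #|[set x in c | w x]|.
Proof.
move=> cR used; set W := [set x in c | w x].
have inW x : (x \in W) = (x \in c) && w x by rewrite inE.
have W0 x : x \in W -> s0 x \in W by rewrite !inW in_r0 // w_flip0.
have [W00|[x xW]] := set_0Vmem W.
  have [x xc] := class_n0 region_rel_sym cR.
  have h := region_full cR xc.
  have /card_gt0P[e] : 0 < #|used_edges| by apply: ltnW.
  rewrite inE => /andP[_ we]; have : rep e \in W.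
    rewrite inW we andbT; apply: h => z zc wz.
    by have : z \in W; [rewrite inW zc | rewrite W00 inE].
  by rewrite W00 inE.
have /[!inW]/andP[xc wx] := xW.
have [v vV xv] := class_ex vertex_rel_sym x.
have [v' vV' xv'] := class_ex vertex_rel_sym (s0 x).
have nx : s0 x \notin v by apply: w_noloop.
have [|y] := even_other (region_vertex_even cR vV) (_ : x \in _).
  by rewrite inE xv andbT.
rewrite inE => /andP[yW yv] yx; have /[!inW]/andP[yc wy] := yW.
have ny : s0 y \notin v by apply: w_noloop.
pose Q := [set x; s0 x; y; s0 y].
have QW : Q \subset W.
  by apply/subsetP => z; rewrite !in_setU !in_set1 -!orbA => /or4P[] /eqP->; rewrite ?W0.
have Q4 : #|Q| = 4.
  rewrite /Q setUC cardsU1 setUC cardsU1 cards2 !inE !negb_or yx.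
  rewrite (can_eq s0K) yx (flip0_free y) (eq_sym x) (flip0_free x).
  have -> : s0 y != x by apply: contraNneq ny => ->.
  by have -> : y != s0 x by apply: contraNneq nx => <-.
have evW : ~~ odd #|W| by apply: (even_card_involution s0K (@flip0_free S)).
rewrite leqNgt; apply/negP => ltW.
have WQ : W = Q.
  apply/eqP; rewrite eq_sym eqEcard QW Q4; move: ltW evW.
  by case: #|W| => [|[|[|[|[|[|]]]]]].
(* The far end of x needs a second drawn flag of c. Only [s0 y] is possible, so x and y lie on edges
   with the same ends, that is, on one edge. *)
have ysx : y = s2 x.
  have [|z] := even_other (region_vertex_even cR vV') (_ : s0 x \in _).
    by rewrite inE xv' andbT; apply: W0.
  rewrite inE -/W WQ !inE -!orbA => /andP[/or4P[]/eqP-> zv zx].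
  - by have := @w_noloop (s0 x) v'; rewrite w_flip0 s0K zv => /(_ wx vV' xv').
  - by rewrite eqxx in zx.
  - by case/negP: nx; rewrite (class_inj vertex_rel_sym vV vV' yv zv).
  - by case: (w_simple wx wy vV vV' xv yv xv' zv) => // exy; rewrite exy eqxx in yx.
(* Both sides of that edge lie in c, so c is everything and there is only one drawn edge. *)
have cT z : z \in c.
  apply: (region_full cR xc) => t tc wt.
  have : t \in W by rewrite inW tc.
  suff : s2 t \in W \/ t \notin W by case=> [|/negP//]; rewrite inW => /andP[].
  rewrite WQ; have [tQ|] := boolP (t \in Q); last by right.
  left; move: tQ; rewrite !inE ysx -!orbA.
  by case/or4P=> /eqP->; rewrite ?s02 ?s2K ?eqxx ?orbT.
have : #|W| = #|[set x | w x]| by apply: eq_card => z; rewrite !inE cT.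
by rewrite card_used_flags WQ Q4; move: used; clear; lia.
Qed.

(** The bound e <= 3(n - eps), times the four flags of an edge. A side of an edge has two flags, so
    six flags mean length 3. *)
Lemma euler_bound : (euler_char S <= 0)%R ->
  (#|[set x | w x]|%:Z <= 12 * (#|N|%:Z - euler_char S))%R.
Proof.
rewrite /euler_char => chi0; have N0 : 0 < #|N| by rewrite card_gt0.
have := euler_regions; rewrite card_used_flags.
have [used|] := ltnP 1 #|used_edges|; last by lia.
suff : 6 * #|regions| <= 4 * #|used_edges| by lia.
rewrite -card_used_flags -[X in _ <= X]sum1_card (eq_bigl (fun x => (x \in [set: S]) && w x)); last first.
  by move=> x; rewrite !inE.
rewrite (set_partition_big_cond _ (classes_partition region_rel_sym)) /=.
rewrite mulnC -sum_nat_const; apply: leq_sum => c cR.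
apply: leq_trans (region_length cR used) _; rewrite -[X in X <= _]sum1_card.
by rewrite (eq_bigl (fun x => (x \in c) && w x)) // => x; rewrite inE.
Qed.

End SubgraphOfSkeleton.

(** * Reducible configurations *)

Section EdgeSets.

Variable V : finType.
Implicit Types (F H : {set {set V}}) (u v : V) (e : {set V}).

Definition nbr F u := [set v | [set u; v] \in F].
Definition deg F u := #|nbr F u|.
Definition inc F u := [set e in F | u \in e].
Definition supp F := [set u | 0 < deg F u].
Definition simple F := {in F, forall e, exists u v, u != v /\ e = [set u; v]}.

Lemma nbr_sym F u v : (v \in nbr F u) = (u \in nbr F v).
Proof. by rewrite !inE setUC. Qed.

Lemma simple_sub F H : H \subset F -> simple F -> simple H.
Proof. by move=> /subsetP HF sF e /HF /sF. Qed.

Lemma nbr_neq F u v : simple F -> v \in nbr F u -> u != v.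
Proof.
move=> sF; rewrite inE => /sF[a [b [ab e]]]; apply: contra_neq ab => uv.
have : a \in [set u; v] by rewrite e !inE eqxx.
have : b \in [set u; v] by rewrite e !inE eqxx orbT.
by rewrite uv !inE !orbb => /eqP-> /eqP->.
Qed.

Lemma set2_inj u v v' : u != v -> [set u; v] = [set u; v'] -> v = v'.
Proof.
move=> uv e; have : v \in [set u; v'] by rewrite -e !inE eqxx orbT.
by rewrite !inE eq_sym (negPf uv) => /eqP.
Qed.

Lemma incE F u : simple F -> inc F u = [set [set u; v] | v in nbr F u].
Proof.
move=> sF; apply/setP => e; rewrite inE; apply/andP/imsetP => [[eF ue]|[v]].
  have [a [b [ab ee]]] := sF e eF; move: ue; rewrite ee !inE => /orP[] /eqP->.
    by exists b; rewrite ?inE -?ee.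
  by exists a; rewrite ?inE ?[[set b; a]]setUC -?ee.
by rewrite inE => vF ->; rewrite vF !inE eqxx.
Qed.

Lemma card_inc F u : simple F -> #|inc F u| = deg F u.
Proof.
move=> sF; rewrite incE // card_in_imset // => v v' vN v'N.
by apply: set2_inj; apply: nbr_neq vN.
Qed.

Lemma deg_sub F H u : H \subset F -> deg H u <= deg F u.
Proof.
by move=> /subsetP HF; apply/subset_leq_card/subsetP => v; rewrite !inE => /HF.
Qed.

Lemma nbr_supp F u v : v \in nbr F u -> v \in supp F.
Proof. by rewrite nbr_sym [v \in supp F]inE => uv; apply/card_gt0P; exists u. Qed.

End EdgeSets.

(** * Labels outside a list of forbidden integers *)

Section Avoid.

Lemma card_avoid (L : {fset int}) (s : seq int) :
  #|` L|%fset <= #|` [fset a in L | a \notin s]%fset|%fset + size s.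
Proof.
have -> : [fset a in L | a \notin s]%fset = (L `\` seq_fset tt s)%fset.
  by apply/fsetP => a; rewrite in_fsetD seq_fsetE !inE andbC.
have h : #|` L `&` seq_fset tt s|%fset <= size s.
  apply: leq_trans (fsubset_leq_card (fsubsetIr _ _)) _.
  by rewrite size_seq_fset size_undup.
rewrite cardfsD; apply: leq_trans (leq_add (leqnn _) h).
by rewrite addnC -maxnE leq_maxr.
Qed.

Lemma avoid (L : {fset int}) (s : seq int) :
  size s < #|` L|%fset -> exists2 a, a \in L & a \notin s.
Proof.
move=> lt; have : 0 < #|` [fset a in L | a \notin s]%fset|%fset.
  by have := card_avoid L s; lia.
by rewrite cardfs_gt0 => /fset0Pn[a]; rewrite !inE /= => /andP[aL as_]; exists a.
Qed.

Variable d : nat.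
Hypothesis d_gt0 : 0 < d.

(** The integers at distance less than d from x, that is, the labels an element labelled x forbids
    across an incidence. *)
Definition near (x : int) : seq int :=
  [seq (x - d%:Z + 1 + i%:Z)%R | i <- iota 0 (2 * d - 1)].

Lemma size_near x : size (near x) = 2 * d - 1.
Proof. by rewrite size_map size_iota. Qed.

Lemma far_near a x : a \notin near x -> (d%:Z <= `|a - x|)%R.
Proof.
move=> an; rewrite leNgt; apply: contra an => lt; apply/mapP.
exists (absz (a - x + d%:Z - 1)%R); last by lia.
by rewrite mem_iota; lia.
Qed.

Lemma size_nears (s : seq int) : size (flatten [seq near x | x <- s]) = size s * (2 * d - 1).
Proof. by elim: s => //= x s IHs; rewrite size_cat size_near IHs mulSn. Qed.

End Avoid.

(** * Extending partial labellings *)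

Section Labellings.

Variables (V : finType) (d M : nat) (E0 : {set {set V}}).
Variables (LV : V -> {fset int}) (LE : {set V} -> {fset int}).
Hypothesis d_gt0 : 0 < d.
Hypothesis E0_simple : simple E0.
Hypothesis LV_card : forall u, #|` LV u|%fset = M + 2 * d.
Hypothesis LE_card : {in E0, forall e, #|` LE e|%fset = M + 2 * d}.

Implicit Types (F H : {set {set V}}) (u v : V) (e f : {set V}).

Definition edge_proper F (ce : {set V} -> int) :=
  forall e f u, e \in F -> f \in F -> e != f -> u \in e -> u \in f -> ce e != ce f.

(* Only edges of F are constrained, but every vertex is labelled.             *)
Definition labelling F (cv : V -> int) (ce : {set V} -> int) :=
  [/\ forall u v, [set u; v] \in F -> cv u != cv v, edge_proper F ce,
      forall e u, e \in F -> u \in e -> (d%:Z <= `|cv u - ce e|)%R,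
      forall u, cv u \in LV u & {in F, forall e, ce e \in LE e}].

Definition labellable F := exists cv ce, labelling F cv ce.

(** Each edge at a vertex of X forbids 2d labels there: one for the neighbour and 2d - 1 for the
    edge. *)
Lemma recolour_vertices F (X : {set V}) cv ce : F \subset E0 ->
    {in X, forall x, 2 * d * deg F x < M + 2 * d} ->
    {in X &, forall x y, [set x; y] \notin F} ->
    (forall u v, u \notin X -> v \notin X -> [set u; v] \in F -> cv u != cv v) ->
    edge_proper F ce ->
    (forall e u, e \in F -> u \in e -> u \notin X -> (d%:Z <= `|cv u - ce e|)%R) ->
    (forall u, u \notin X -> cv u \in LV u) -> {in F, forall e, ce e \in LE e} ->
  labellable F.
Proof.
move=> FE Xdeg Xind cvP ceP cvceP cvL ceL; have sF := simple_sub FE E0_simple.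
have /fin_all_exists[cx cxP] u : exists a, u \in X ->
    [/\ a \in LV u, forall v, v \in nbr F u -> a != cv v
     & forall e, e \in inc F u -> (d%:Z <= `|a - ce e|)%R].
  have [uX|] := boolP (u \in X); last by exists 0%R.
  have [|a aL] := @avoid (LV u)
    ([seq cv v | v <- enum (nbr F u)] ++ flatten [seq near d (ce e) | e <- enum (inc F u)]).
    rewrite size_cat size_map (map_comp (near d) ce) size_nears // size_map -!cardE.
    rewrite card_inc // -/(deg F u) LV_card; have := Xdeg u uX.
    by rewrite -mulnS (_ : (2 * d - 1).+1 = 2 * d) 1?mulnC //; lia.
  rewrite mem_cat negb_or => /andP[aV aE]; exists a => _; split=> // [v vN|e eI].
    by apply: contraNneq aV => ->; apply: map_f; rewrite mem_enum.
  apply: far_near => //; apply: contra aE => aN; apply/flatten_mapP.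
  by exists e; rewrite ?mem_enum.
exists (fun u => if u \in X then cx u else cv u), ce; split=> //.
- move=> u v uv; case: ifP => uX; case: ifP => vX.
  + by have := Xind u v uX vX; rewrite uv.
  + by have [_ h _] := cxP u uX; apply: h; rewrite inE.
  + by have [_ h _] := cxP v vX; rewrite eq_sym; apply: h; rewrite inE setUC.
  + by apply: cvP; rewrite ?uX ?vX.
- move=> e u eF ue; case: ifP => uX; last by apply: cvceP; rewrite ?uX.
  by have [_ _ h] := cxP u uX; apply: h; rewrite inE eF.
- move=> u; case: ifP => uX; last by apply: cvL; rewrite uX.
  by have [] := cxP u uX.
Qed.

(** The edge uv avoids its adjacent edges and the label of v, in all at most M + 2d - 1 labels; a
    conflict with u is repaired by relabelling u. *)
Lemma edge_reducible F u v : F \subset E0 -> [set u; v] \in F ->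
    2 * d * deg F u < M + 2 * d -> deg F u + deg F v <= M + 2 ->
  labellable (F :\ [set u; v]) -> labellable F.
Proof.
set e0 := [set u; v] => FE e0F degu degv [cv [ce [cvP ceP cvceP cvL ceL]]].
have sF := simple_sub FE E0_simple.
have ue : u \in e0 by rewrite !inE eqxx.
have ve : v \in e0 by rewrite !inE eqxx orbT.
have cD w : w \in e0 -> #|inc F w :\ e0|.+1 = deg F w.
  by move=> we; rewrite -card_inc // (cardsD1 e0 (inc F w)) inE e0F we.
have [|a aL] := @avoid (LE e0) ([seq ce e | e <- enum (inc F u :\ e0)] ++
    [seq ce e | e <- enum (inc F v :\ e0)] ++ near d (cv v)).
  rewrite !size_cat !size_map size_iota -!cardE LE_card ?(subsetP FE) //.
  have -> : #|inc F u :\ e0| = (deg F u).-1 by rewrite -(cD u ue).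
  have -> : #|inc F v :\ e0| = (deg F v).-1 by rewrite -(cD v ve).
  by have := cD u ue; have := cD v ve; move: degv d_gt0; clear; lia.
rewrite !mem_cat !negb_or => /and3P[au av an].
have anew w e : w \in e0 -> e \in F -> w \in e -> e != e0 -> a != ce e.
  move=> we eF wE ne; rewrite !inE in we.
  case/orP: we => /eqP ew; move: wE; rewrite ew => wE.
    by apply: contraNneq au => ->; apply: map_f; rewrite mem_enum !inE ne eF.
  by apply: contraNneq av => ->; apply: map_f; rewrite mem_enum !inE ne eF.
apply: (@recolour_vertices F [set u] cv (fun e => if e == e0 then a else ce e)) => //.
- by move=> x /set1P->.
- move=> x y /set1P-> /set1P->; apply/negP => uu.
  by have := @nbr_neq _ F u u sF; rewrite inE uu eqxx => /(_ isT).
- move=> x y; rewrite !in_set1 => xu yu xyF; apply: cvP; rewrite !in_setD1 xyF andbT.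
  apply: contraTneq ue => <-; rewrite !inE negb_or.
  by rewrite ![u == _]eq_sym xu yu.
- move=> e f w eF fF ef we wf; case: ifP => [/eqP ee|/negbT ne]; case: ifP => [/eqP fe|/negbT nf].
  + by rewrite ee fe eqxx in ef.
  + by apply: (anew w) => //; rewrite -ee.
  + by rewrite eq_sym; apply: (anew w) => //; rewrite -fe.
  + by apply: (ceP _ _ w); rewrite // !inE ?ne ?nf.
- move=> e w eF we; rewrite in_set1 => wu; case: eqP => [ee|/eqP ne].
    move: we; rewrite ee !inE (negPf wu) => /eqP->.
    by rewrite distrC; apply: far_near.
  by apply: cvceP; rewrite // !inE ne.
- move=> e eF; case: eqP => [->//|/eqP ne].
  by apply: ceL; rewrite !inE ne.
Qed.

(** All edges at X are relabelled at once, with X as the left side. An edge xy keeps at least M + 1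
    - deg y + |N(y) :&: X| labels, enough for the bipartite theorem; then X is relabelled. *)
Lemma alternator_reducible F (X : {set V}) k : F \subset E0 ->
    {in X, forall x, deg F x <= k} -> 2 * d * k < M + 2 * d ->
    {in X &, forall x y, [set x; y] \notin F} ->
    (forall x y, x \in X -> y \in nbr F x ->
      deg F y <= M /\ deg F y + k <= #|nbr F y :&: X| + M + 1) ->
    labellable [set e in F | [disjoint e & X]] ->
  labellable F.
Proof.
set H := [set e in F | _] => FE Xk kK Xind alt [cv [ce [cvP ceP cvceP cvL ceL]]].
have sF := simple_sub FE E0_simple.
have HF : H \subset F by apply/subsetP => e; rewrite inE => /andP[].
pose P := [set p : V * V | (p.1 \in X) && ([set p.1; p.2] \in F)].
have P2 p : p \in P -> p.2 \notin X.
  rewrite inE => /andP[p1 pF]; apply: contraL pF => p2; exact: Xind.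
(* Conflicts with the end in X are ignored here, since that end is relabelled last. *)
pose L (p : V * V) := [fset a in LE [set p.1; p.2] |
  a \notin near d (cv p.2) ++ [seq ce e | e <- enum (inc H p.2)]]%fset.
have degl_k x : degl P x <= k.
  have [xX|xX] := boolP (x \in X); last first.
    rewrite /degl (_ : [set _ in _ | _] = set0) ?cards0 //; apply/setP => p; rewrite !inE.
    by apply/negP => /andP[/andP[p1 _] /eqP e]; rewrite -e p1 in xX.
  apply: leq_trans (Xk x xX).
  rewrite /deg -(card_imset (mem (nbr F x)) (f := fun v => (x, v))); last by move=> v v' [].
  apply/subset_leq_card/subsetP => -[a b]; rewrite !inE /=.
  case/andP=> /andP[_ ab] /eqP ax; apply/imsetP; exists b; rewrite ?inE -?ax //.
have degrE y : degr P y = #|nbr F y :&: X|.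
  rewrite /degr -(card_imset (mem (nbr F y :&: X)) (f := fun v => (v, y))); last first.
    by move=> v v' [].
  apply: eq_card => -[a b]; rewrite !inE /=; apply/andP/imsetP.
    case=> /andP[aX ab] /eqP <-; exists a => //.
    by rewrite !inE aX setUC ab.
  by case=> x; rewrite !inE => /andP[yx xX] [-> ->]; rewrite xX setUC yx.
have [|c [cL cP]] := bipartite_list_colouring degl_k (L := L).
  move=> [x y] xyP /=; have := xyP; rewrite inE /= => /andP[xX xyF].
  have yN : y \in nbr F x by rewrite inE.
  have [degM degk] := alt x y xX yN.
  have := card_avoid (LE [set x; y])
    (near d (cv y) ++ [seq ce e | e <- enum (inc H y)]).
  rewrite LE_card ?(subsetP FE) // size_cat size_near size_map -cardE card_inc; last first.
    exact: simple_sub HF sF.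
  have -> : deg H y = deg F y - #|nbr F y :&: X|.
    rewrite /deg -cardsD; apply: eq_card => z; rewrite !inE.
    case zF: (_ \in F); rewrite ?andbF //= disjoint_sym disjoints_subset ?andbT.
    have yX := P2 _ xyP; apply/subsetP/idP => /= [h|zX].
      by apply/negP => /h; rewrite !inE eqxx orbT.
    move=> t tX; rewrite !inE negb_or; apply/andP; split.
      by apply: contraNneq yX => /= <-.
    by apply: contraNneq zX => <-.
  rewrite [X in _ <= X -> _]addnC -leq_subLR => h; refine (leq_trans _ h); rewrite degrE.
  have := subset_leq_card (subsetIl (nbr F y) X); rewrite -/(deg F y).
  by move: degM degk d_gt0; clear; lia.
have /fin_all_exists[cn cnP] e : exists a, e \in F -> e \notin H ->
    exists p, [/\ p \in P, e = [set p.1; p.2] & a = c p].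
  have [eF|] := boolP (e \in F); last by exists 0%R.
  have [|] := boolP (e \in H); first by exists 0%R.
  rewrite inE eF /= => /pred0Pn[x /= /andP[xe xX]].
  have : e \in inc F x by rewrite inE eF.
  rewrite incE // => /imsetP[y]; rewrite inE => xyF ->.
  by exists (c (x, y)) => _ _; exists (x, y); rewrite inE /= xX.
have Pnear p : p \in P -> (d%:Z <= `|cv p.2 - c p|)%R.
  move=> /cL; rewrite !inE mem_cat negb_or => /and3P[_ h _].
  by rewrite distrC; apply: far_near.
have Pnew p e : p \in P -> e \in H -> p.2 \in e -> c p != ce e.
  move=> pP eH pe; have := cL p pP; rewrite !inE mem_cat negb_or => /and3P[_ _ h].
  by apply: contraNneq h => ->; apply: map_f; rewrite mem_enum in_set eH.
have HX e x : e \in H -> x \in e -> x \notin X.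
  by rewrite inE => /andP[_ /pred0P h] xe; apply/negP => xX; have := h x; rewrite /= xe xX.
apply: (@recolour_vertices F X cv (fun e => if e \in H then ce e else cn e)) => //.
- by move=> x /Xk h; apply: leq_ltn_trans kK; rewrite leq_mul2l h orbT.
- move=> u v uX vX uvF; apply: cvP; rewrite inE uvF; apply/pred0P => x /=.
  by rewrite !inE; apply/negP => /andP[/orP[] /eqP->]; apply/negP.
- move=> e f w eF fF ef we wf.
  case: ifP => [eH|/negbT eH]; case: ifP => [fH|/negbT fH].
  + exact: (ceP e f w).
  + have [p [pP fE ->]] := cnP f fF fH; rewrite eq_sym; apply: Pnew => //.
    have pX : p.1 \in X by move: pP; rewrite inE => /andP[].
    move: wf; rewrite fE !inE => /orP[] /eqP wp; rewrite -?wp //.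
    by have := HX e w eH we; rewrite wp pX.
  + have [p [pP eE ->]] := cnP e eF eH; apply: Pnew => //.
    have pX : p.1 \in X by move: pP; rewrite inE => /andP[].
    move: we; rewrite eE !inE => /orP[] /eqP wp; rewrite -?wp //.
    by have := HX f w fH wf; rewrite wp pX.
  + have [p [pP eE ->]] := cnP e eF eH; have [q [qP fE ->]] := cnP f fF fH.
    apply: contra_neq ef => cpq; rewrite eE fE; suff -> : p = q by [].
    apply: cP => //.
    have pX : p.1 \in X by move: pP; rewrite inE => /andP[].
    have qX : q.1 \in X by move: qP; rewrite inE => /andP[].
    have p2 := P2 p pP; have q2 := P2 q qP.
    move: we wf; rewrite eE fE !inE => /orP[] /eqP-> /orP[] /eqP pq; auto.
      by rewrite -pq pX in q2.
    by rewrite pq qX in p2.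
- move=> e u eF ue uX; case: ifP => [eH|/negbT eH]; first exact: cvceP.
  have [p [pP eE ->]] := cnP e eF eH.
  have pX : p.1 \in X by move: pP; rewrite inE => /andP[].
  move: ue; rewrite eE !inE => /orP[] /eqP up; last by rewrite up Pnear.
  by rewrite up pX in uX.
- move=> e eF; case: ifP => [eH|/negbT eH]; first exact: ceL.
  have [p [pP eE ->]] := cnP e eF eH; have := cL p pP.
  by rewrite !inE -eE => /andP[].
Qed.

Lemma vertex_colouring F : F \subset E0 -> (forall u, deg F u <= M) ->
  exists2 cv : V -> int, (forall u, cv u \in LV u) &
    forall u v, [set u; v] \in F -> cv u != cv v.
Proof.
move=> FE degM; have sF := simple_sub FE E0_simple.
suff [cv cvL cvP] : exists2 cv : V -> int, (forall u, cv u \in LV u) &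
    {in enum V &, forall u v, [set u; v] \in F -> cv u != cv v}.
  by exists cv => // u v; apply: cvP; rewrite mem_enum.
elim: (enum V) => [|x s [cv cvL cvP]].
  have /fin_all_exists[cv cvL] u : exists a, a \in LV u.
    have [|a aL _] := @avoid (LV u) [::]; first by rewrite LV_card /=; lia.
    by exists a.
  by exists cv.
have [|a aL aN] := @avoid (LV x) [seq cv v | v <- enum (nbr F x)].
  by rewrite size_map -cardE LV_card; have := degM x; rewrite /deg; move: d_gt0; clear; lia.
have aP v : [set x; v] \in F -> a != cv v.
  by move=> xv; apply: contraNneq aN => ->; apply: map_f; rewrite mem_enum inE.
exists (fun u => if u == x then a else cv u) => [u|u v].
  by case: eqP => [->|].
have xx : [set x; x] \notin F.
  by apply/negP => h; have := @nbr_neq _ F x x sF; rewrite inE h eqxx => /(_ isT).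
rewrite !inE => /predU1P[->|us] /predU1P[->|vs].
- by rewrite (negPf xx).
- by rewrite eqxx; case: (eqVneq v x) => [->|_ /aP//]; rewrite (negPf xx).
- rewrite eqxx; case: (eqVneq u x) => [->|_]; rewrite ?(negPf xx) //.
  by rewrite setUC eq_sym => /aP.
case: (eqVneq u x) => [->|_]; case: (eqVneq v x) => [->|_].
- by rewrite (negPf xx).
- exact: aP.
- by rewrite setUC eq_sym => /aP.
- exact: cvP.
Qed.

(** Greedy: with both ends labelled, an edge uv has at most deg u + deg v - 2 + 2(2d - 1) forbidden
    labels. *)
Lemma edge_colouring F cv : F \subset E0 ->
    (forall H, H \subset F -> H != set0 -> exists u v,
      [set u; v] \in H /\ deg H u + deg H v + 2 * d < M + 4) ->
  exists ce : {set V} -> int, [/\ edge_proper F ce,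
    forall e u, e \in F -> u \in e -> (d%:Z <= `|cv u - ce e|)%R
    & {in F, forall e, ce e \in LE e}].
Proof.
have [n] := ubnP #|F|; elim: n => // n IHn in F * => ltn FE deg_small.
have sF := simple_sub FE E0_simple.
have [->|F0] := eqVneq F set0.
  by exists (fun=> 0%R); split=> [e f u|e u|e]; rewrite inE.
have [u [v [e0F lt]]] := deg_small F (subxx F) F0.
set e0 := [set u; v] in e0F.
have F'F : F :\ e0 \subset F := subD1set F e0.
have [|||ce [ceP cvceP ceL]] := IHn (F :\ e0).
- by move: ltn; rewrite (cardsD1 e0) e0F.
- exact: subset_trans F'F FE.
- by move=> H HF; apply: deg_small; apply: subset_trans HF F'F.
have ue : u \in e0 by rewrite !inE eqxx.
have ve : v \in e0 by rewrite !inE eqxx orbT.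
have cD w : w \in e0 -> #|inc F w :\ e0|.+1 = deg F w.
  by move=> we; rewrite -card_inc // (cardsD1 e0 (inc F w)) inE e0F we.
have [|a aL] := @avoid (LE e0) ([seq ce e | e <- enum (inc F u :\ e0)] ++
    [seq ce e | e <- enum (inc F v :\ e0)] ++ near d (cv u) ++ near d (cv v)).
  rewrite !size_cat !size_map !size_iota -!cardE LE_card ?(subsetP FE) //.
  have -> : #|inc F u :\ e0| = (deg F u).-1 by rewrite -(cD u ue).
  have -> : #|inc F v :\ e0| = (deg F v).-1 by rewrite -(cD v ve).
  by have := cD u ue; have := cD v ve; move: lt d_gt0; clear; lia.
rewrite !mem_cat !negb_or => /and4P[au av anu anv].
have anew w e : w \in e0 -> e \in F -> w \in e -> e != e0 -> a != ce e.
  move=> we eF wE ne; rewrite !inE in we.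
  case/orP: we => /eqP ew; move: wE; rewrite ew => wE.
    by apply: contraNneq au => ->; apply: map_f; rewrite mem_enum !inE ne eF.
  by apply: contraNneq av => ->; apply: map_f; rewrite mem_enum !inE ne eF.
exists (fun e => if e == e0 then a else ce e); split.
- move=> e f w eF fF ef we wf.
  case: ifP => [/eqP ee|/negbT ne]; case: ifP => [/eqP fe|/negbT nf].
  + by rewrite ee fe eqxx in ef.
  + by apply: (anew w) => //; rewrite -ee.
  + by rewrite eq_sym; apply: (anew w) => //; rewrite -fe.
  + by apply: (ceP _ _ w); rewrite // !inE ?ne ?nf.
- move=> e w eF we; case: eqP => [ee|/eqP ne]; last by apply: cvceP; rewrite // !inE ne.
  rewrite distrC; apply: far_near => //.
  by move: we; rewrite ee !inE => /orP[] /eqP->.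
- move=> e eF; case: eqP => [->//|/eqP ne].
  by apply: ceL; rewrite !inE ne.
Qed.

(* Once the vertices are labelled, each edge keeps at least M + 2 - 2d labels. *)
Lemma dense_core F : F \subset E0 -> (forall u, deg F u <= M) -> ~ labellable F ->
  exists H, [/\ H \subset F, H != set0 &
    forall u v, [set u; v] \in H -> M + 4 <= deg H u + deg H v + 2 * d].
Proof.
move=> FE degM nl; apply: contra_notP nl => nH.
have [cv cvL cvP] := vertex_colouring FE degM.
have [|ce [ceP cvceP ceL]] := @edge_colouring F cv FE.
  move=> H HF H0; apply: contra_notP nH => nuv; exists H; split=> // u v uv.
  by rewrite leqNgt; apply/negP => lt; apply: nuv; exists u, v.
by exists cv, ce.
Qed.

End Labellings.

(** * Degree sums *)

Section Drawing.

Variables (G : sgraph) (S : surface) (phi : G -> {set S}) (F : {set {set G}}).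
Hypothesis phiP : embedding phi.
Hypothesis FE : F \subset edge_set G.

Lemma edge_set_simple : simple (edge_set G).
Proof.
move=> e /imsetP[[u v]]; rewrite inE /= => uv ->; exists u, v; split=> //.
by apply: contraTneq uv => ->; rewrite adj_irr.
Qed.

Lemma adj_edge_set (u v : G) : [set u; v] \in edge_set G -> adj u v.
Proof.
move=> uvE; have neq : u != v by apply: (nbr_neq edge_set_simple); rewrite inE.
case/imsetP: uvE => -[a b]; rewrite inE /= => ab e.
have : u \in [set a; b] by rewrite -e !inE eqxx.
have : v \in [set a; b] by rewrite -e !inE eqxx orbT.
rewrite !inE => /orP[] /eqP ev /orP[] /eqP eu; move: neq; rewrite eu ev ?eqxx //.
by rewrite adj_sym.
Qed.

Lemma dart_sum : \sum_u deg F u = #|[set p : G * G | [set p.1; p.2] \in F]|.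
Proof.
rewrite -sum_card -(pair_bigA _ (fun u v => ([set u; v] \in F : nat))) /=.
by apply: eq_bigr => u _; rewrite sum_card; apply: eq_card => v; rewrite !inE.
Qed.

Lemma degree_sum : F != set0 -> (euler_char S <= 0)%R ->
  ((\sum_u deg F u)%:Z <= 6 * (#|supp F|%:Z - euler_char S))%R.
Proof.
case: phiP => phi_inj phiV phi_adj F0 chi.
have sF := simple_sub FE edge_set_simple.
have phi_eq u v x : x \in phi u -> x \in phi v -> u = v.
  move=> xu xv; apply: phi_inj.
  exact: (class_inj (@vertex_rel_sym S) (phiV u) (phiV v) xu xv).
have phi2 u x : (flip2 x \in phi u) = (x \in phi u) by apply: in_v2.
(* The skeleton may join two vertices by several edges, so one flag is fixed for each edge of F. *)
have /fin_all_exists[xe xeP] e : exists x : S, e \in F -> exists u v,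
    [/\ e = [set u; v], x \in phi u & flip0 x \in phi v].
  have [eF|_] := boolP (e \in F); last first.
    by have /card_gt0P[x _] := flag_inhabited S; exists x.
  have [u [v [_ ee]]] := sF e eF.
  have [|x xu xv] := phi_adj u v.
    by apply: adj_edge_set; rewrite -ee (subsetP FE).
  by exists x => _; exists u, v.
pose Q x : {set S} := [set x; flip0 x; flip2 x; flip0 (flip2 x)].
pose w x := [exists e in F, x \in Q (xe e)].
have Q0 x y : (flip0 y \in Q x) = (y \in Q x).
  have h z : z \in Q x -> flip0 z \in Q x.
    by rewrite !inE -!orbA => /or4P[] /eqP->; rewrite ?flip0K ?eqxx ?orbT.
  by apply/idP/idP => /h //; rewrite flip0K.
have Q2 x y : (flip2 y \in Q x) = (y \in Q x).
  have h z : z \in Q x -> flip2 z \in Q x.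
    by rewrite !inE -!orbA => /or4P[] /eqP->;
      rewrite -?flip02C ?flip2K ?eqxx ?orbT.
  by apply/idP/idP => /h //; rewrite flip2K.
have w0 x : w (flip0 x) = w x by apply: eq_existsb => e; rewrite Q0.
have w2 x : w (flip2 x) = w x by apply: eq_existsb => e; rewrite Q2.
have Qdart e x : e \in F -> x \in Q (xe e) -> exists u v,
    [/\ e = [set u; v], x \in phi u & flip0 x \in phi v].
  move=> eF; have [u [v [ee xu xv]]] := xeP e eF.
  rewrite !inE -!orbA => /or4P[] /eqP->.
  - by exists u, v.
  - by exists v, u; rewrite flip0K setUC.
  - by exists u, v; rewrite flip02C !phi2.
  - by exists v, u; rewrite flip0K flip02C !phi2 setUC.
have wP x : w x -> exists u v,
    [/\ [set u; v] \in F, x \in Q (xe [set u; v]), x \in phi u & flip0 x \in phi v].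
  case/existsP=> e /andP[eF xQ]; have [u [v [ee xu xv]]] := Qdart e x eF xQ.
  by exists u, v; rewrite -ee.
have Qsym x y z : x \in Q z -> y \in Q z -> y \in Q x.
  move=> xz yz; have zx : z \in Q x.
    by move: xz; rewrite !inE -!orbA => /or4P[] /eqP->;
      rewrite ?flip0K ?flip2K -?flip02C ?flip0K ?flip2K ?eqxx ?orbT.
  have /or4P yE : [|| y == z, y == flip0 z, y == flip2 z | y == flip0 (flip2 z)].
    by move: yz; rewrite !inE -!orbA.
  by case: yE => /eqP->; rewrite ?Q0 ?Q2.
have vcl u v x : v \in cell_vertices S -> x \in v -> x \in phi u -> v = phi u.
  by move=> vV xv xu; apply: (class_inj (@vertex_rel_sym S) vV (phiV u) xv xu).
have noloop x v : w x -> v \in cell_vertices S -> x \in v -> flip0 x \notin v.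
  move=> /wP[a [b [abF _ xa xb]]] vV xv; rewrite (vcl a v x) //.
  have : a != b by apply: (nbr_neq sF); rewrite inE.
  by apply: contra_neqN => xa'; apply: phi_eq xa' xb.
have bound : (#|[set x | w x]|%:Z <= 12 * (#|supp F|%:Z - euler_char S))%R.
  have <- : #|phi @: supp F| = #|supp F| by apply: card_imset.
  apply: euler_bound => //.
  - by apply/subsetP => v /imsetP[u _ ->].
  - have [e eF] := set0Pn _ F0; have [u [v [_ ee]]] := sF e eF.
    by apply/set0Pn; exists (phi v); apply: imset_f; apply: (@nbr_supp _ F u); rewrite inE -ee.
  - move=> x v /wP[a [b [abF _ xa _]]] vV xv; rewrite (vcl a v x) //; apply: imset_f.
    by apply: (@nbr_supp _ F b); rewrite inE setUC.
  - move=> x y v v' wx wy vV vV' xv yv xv' yv'.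
    have [a [b [abF xQ xa xb]]] := wP x wx; have [a' [b' [abF' yQ ya yb]]] := wP y wy.
    have ea : a' = a by apply: phi_inj; rewrite -(vcl a' v y) // (vcl a v x).
    have eb : b' = b by apply: phi_inj; rewrite -(vcl b' v' (flip0 y)) // (vcl b v' (flip0 x)).
    rewrite ea eb in yQ; have := Qsym _ _ _ xQ yQ.
    have nx := noloop x v wx vV xv.
    rewrite !inE -!orbA => /or4P[] /eqP ey; auto; case/negP: nx; rewrite -?ey //.
    by rewrite -(in_v2 (flip0 x) vV) -flip02C -ey.
suff : (2 * \sum_u deg F u <= #|[set x | w x]|)%N by lia.
rewrite dart_sum; set D := [set p : G * G | _].
have /fin_all_exists[z zP] (p : G * G) : exists z : S, p \in D ->
    [/\ w z, z \in phi p.1 & flip0 z \in phi p.2].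
  have [|_] := boolP (p \in D); last first.
    by have /card_gt0P[x _] := flag_inhabited S; exists x.
  case: p => u v; rewrite inE /= => uvF; have [a [b [ee xa xb]]] := xeP _ uvF.
  have wx : w (xe [set u; v]) by apply/existsP; exists [set u; v]; rewrite uvF !inE eqxx.
  have nuv : u != v by apply: (nbr_neq sF); rewrite inE.
  set x := xe [set u; v] in wx xa xb.
  have : u \in [set a; b] by rewrite -ee !inE eqxx.
  have : v \in [set a; b] by rewrite -ee !inE eqxx orbT.
  rewrite !inE => /orP[] /eqP ev /orP[] /eqP eu.
  - by rewrite ev eu eqxx in nuv.
  - by exists (flip0 x) => _; rewrite w0 flip0K eu ev.
  - by exists x => _; rewrite eu ev.
  - by rewrite ev eu eqxx in nuv.
(* Each dart receives two flags, swapped by [flip2]; the vertices at a flag and at its [flip0]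
   recover the dart. *)
pose h (p : (G * G) * bool) : S := if p.2 then flip2 (z p.1) else z p.1.
have hinj : {in setX D [set: bool] &, injective h}.
  move=> [[u v] b] [[u' v'] b']; rewrite !inE /= !andbT => uvF uvF' hh.
  have uvD : (u, v) \in D by rewrite inE.
  have uvD' : (u', v') \in D by rewrite inE.
  have [_ /= zu zv] := zP (u, v) uvD.
  have [_ /= zu' zv'] := zP (u', v') uvD'.
  have hu : h ((u, v), b) \in phi u by rewrite /h /=; case: b {hh}; rewrite ?phi2.
  have hu' : h ((u, v), b) \in phi u' by rewrite hh /h /=; case: b' {hh}; rewrite ?phi2.
  have hv : flip0 (h ((u, v), b)) \in phi v.
    by rewrite /h /=; case: b {hh hu hu'}; rewrite ?flip02C ?phi2.
  have hv' : flip0 (h ((u, v), b)) \in phi v'.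
    by rewrite hh /h /=; case: b' {hh hu hu' hv}; rewrite ?flip02C ?phi2.
  have eu := phi_eq _ _ _ hu hu'; have ev := phi_eq _ _ _ hv hv'.
  move: hh; rewrite -eu -ev /h /=; case: b {hu hu' hv hv'}; case: b' => // /eqP.
    by rewrite (negPf (flip2_free _)).
  by rewrite eq_sym (negPf (flip2_free _)).
have -> : 2 * #|D| = #|h @: setX D [set: bool]|.
  by rewrite card_in_imset // cardsX cardsT card_bool mulnC.
apply/subset_leq_card/subsetP => x /imsetP[[p b]]; rewrite in_setX => /andP[/= pD _] ->.
by have [wz _ _] := zP p pD; rewrite inE /h /=; case: b; rewrite ?w2.
Qed.

End Drawing.

Lemma sum_mem (T : finType) (A B : {set T}) : A \subset B ->
  \sum_(u in B) (u \in A : nat) = #|A|.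
Proof.
move=> AB; rewrite big_mkcond -sum1_card [RHS]big_mkcond; apply: eq_bigr => u _.
by case uA: (u \in A); [rewrite (subsetP AB) | case: (u \in B)].
Qed.

(* delta is the minimum degree of the dense core: some vertex of the core has *)
(* delta neighbours, each of degree at least A = M + 4 - 2d - delta.          *)
Lemma dense_core_bound (d M K delta : nat) : 2 <= d -> 6 <= K -> 2 * d * K.-1 < M ->
    0 < delta ->
  let m := maxn delta K.+1 in let A := M + 4 - 2 * d - delta in
  (K - 5) * (M + 2 - K) <= (m - 6) * (maxn A delta).+1 + (A - m) * delta.
Proof.
move=> d2 K6 KM d0 /=.
have [k Ek] : exists k, K = k + 6 by exists (K - 6); lia.
have [c Ec] : exists c, d = c + 2 by exists (d - 2); lia.
have KM' : 2 * (c + 2) * (k + 5) < M by move: KM; rewrite Ek Ec (_ : (k + 6).-1 = k + 5); last lia.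
rewrite Ek Ec {K K6 KM d d2 Ek Ec}.
have -> : k + 6 - 5 = k + 1 by lia.
(* Three cases: delta <= K + 1, where m = K + 1; K + 1 < delta <= A; and delta above both, where A -
   m = 0 and the first term suffices. *)
have [le|lt] := leqP delta (k + 7).
  rewrite (maxn_idPr _); last by lia.
  have [j Ej] : exists j, delta + j = k + 7 by exists (k + 7 - delta); lia.
  have [a Ea] : exists a, M + 4 - 2 * (c + 2) - delta = a + k + 7.
    by exists (M + 4 - 2 * (c + 2) - delta - k - 7); nia.
  rewrite Ea; have := leq_maxl (a + k + 7) delta.
  move: (maxn _ delta) => B leB.
  have -> : a + k + 7 - (k + 6).+1 = a by lia.
  have -> : (k + 6).+1 - 6 = k + 1 by lia.
  have EM : M = a + k + 7 + delta + 2 * c by nia.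
  apply: leq_trans (_ : (k + 1) * (a + k + 8) + a * delta <= _); last first.
    by rewrite leq_add2r leq_mul2l; lia.
  have ha : (2 * c + 2) * (k + 4) <= a + 1 by nia.
  have -> : M + 2 - (k + 6) = a + delta + 2 * c + 3 by lia.
  nia.
have [t Et] : exists t, delta = k + 8 + t by exists (delta - k - 8); lia.
rewrite (maxn_idPl _); last by lia.
have [le|lt'] := leqP delta (M + 4 - 2 * (c + 2) - delta).
  have [r Er] : exists r, M + 4 - 2 * (c + 2) - delta = delta + r.
    by exists (M + 4 - 2 * (c + 2) - delta - delta); lia.
  rewrite Er; have -> : delta + r - delta = r by lia.
  have -> : M + 2 - (k + 6) = 2 * delta + r + 2 * c - k - 4 by lia.
  rewrite Et; have -> : 2 * (k + 8 + t) + r + 2 * c - k - 4 = k + 12 + 2 * t + r + 2 * c by lia.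
  have -> : k + 8 + t - 6 = k + 2 + t by lia.
  have h : 2 * (c + 2) * (k + 5) < 2 * (k + 8 + t) + r + 2 * (c + 2) - 4 by lia.
  nia.
apply: leq_trans (_ : (k + 1) * (k + 11 + 2 * t + 2 * c) <= _).
  by rewrite leq_mul2l; lia.
have ht : c * k + 4 * c + k + 3 <= t by nia.
apply: leq_trans (leq_addr _ _); rewrite Et.
have -> : k + 8 + t - 6 = k + 2 + t by lia.
nia.
Qed.

(** * Discharging in a minimal unlabellable edge set *)

Section CriticalEdgeSet.

Variables (V : finType) (d M K : nat) (E0 F : {set {set V}}).
Variables (LV : V -> {fset int}) (LE : {set V} -> {fset int}).
Hypothesis d_ge2 : 2 <= d.
Hypothesis K_ge6 : 6 <= K.
Hypothesis K_M : 2 * d * K.-1 < M.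
Hypothesis E0_simple : simple E0.
Hypothesis E0_deg : forall u, deg E0 u <= M.
Hypothesis LV_card : forall u, #|` LV u|%fset = M + 2 * d.
Hypothesis LE_card : {in E0, forall e, #|` LE e|%fset = M + 2 * d}.

Notation labellable := (labellable d LV LE).

Hypothesis FE : F \subset E0.
Hypothesis F_min : forall H : {set {set V}}, H \proper F -> labellable H.
Hypothesis F_bad : ~ labellable F.

Let d_gt0 : 0 < d. Proof. exact: ltnW. Qed.
Let sF : simple F. Proof. exact: simple_sub FE E0_simple. Qed.
Let K_small : 4 * K <= M + 3. Proof. by move: d_ge2 K_ge6 K_M; clear; nia. Qed.
Let K_list : 2 * d * K < M + 2 * d.
Proof. by case: K K_ge6 K_M => // k _ /=; clear; lia. Qed.
Let F_deg u : deg F u <= M.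
Proof. exact: leq_trans (deg_sub u FE) (E0_deg u). Qed.

Definition low k := [set u in supp F | deg F u <= k].

Lemma low_edge u v : [set u; v] \in F -> deg F u <= K -> M + 3 <= deg F u + deg F v.
Proof.
move=> uvF uK; rewrite leqNgt; apply/negP => lt; apply: F_bad.
apply: (edge_reducible d_gt0 E0_simple LV_card LE_card FE uvF).
- by apply: leq_ltn_trans K_list; rewrite leq_mul2l uK orbT.
- by move: lt; clear; lia.
- by apply: F_min; apply: properD1.
Qed.

Lemma supp_deg_ge3 u : u \in supp F -> 3 <= deg F u.
Proof.
rewrite inE => /card_gt0P[v]; rewrite inE => uvF; rewrite leqNgt; apply/negP => lt.
have uK : deg F u <= K by move: lt K_ge6; clear; lia.
by have := low_edge uvF uK; have := F_deg v; move: lt; clear; lia.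
Qed.

Lemma low_independent u v : deg F u <= K -> deg F v <= K -> [set u; v] \notin F.
Proof.
move=> uK vK; apply/negP => uvF; have := low_edge uvF uK.
by move: uK vK K_small K_ge6; clear; lia.
Qed.

Lemma no_alternator k (X : {set V}) : k <= K -> X \subset low k -> X != set0 ->
  exists x y, [/\ x \in X, y \in nbr F x & #|nbr F y :&: X| + M + 2 <= deg F y + k].
Proof.
move=> kK /subsetP Xlow /set0Pn[x0 x0X]; apply: contra_notP F_bad => nalt.
have Xk x : x \in X -> deg F x <= k by move=> /Xlow; rewrite inE => /andP[].
apply: (alternator_reducible d_gt0 E0_simple LV_card LE_card FE Xk).
- by apply: leq_ltn_trans K_list; rewrite leq_mul2l kK orbT.
- by move=> x y /Xk xk /Xk yk; apply: low_independent; apply: leq_trans kK.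
- move=> x y xX yx; split; first exact: F_deg.
  rewrite leqNgt; apply/negP => lt; apply: nalt; exists x, y; split=> //.
  by move: lt; clear; lia.
apply: F_min; apply/properP; split; first by apply/subsetP => e; rewrite inE => /andP[].
have := Xlow _ x0X; rewrite !inE => /andP[/card_gt0P[v]]; rewrite inE => xvF _.
exists [set x0; v]; rewrite // inE xvF /=; apply/pred0Pn; exists x0.
by rewrite /= !inE eqxx.
Qed.

(** [no_alternator] gives a vertex y with at most k - 2 neighbours in X. Removing them from X also
    removes y from the neighbourhood of X, so induction applies; [low_edge] makes all these
    neighbours large. *)
Lemma low_card k : k <= K -> #|low k| <= (k - 2) * #|[set u | M + 3 <= deg F u + k]|.
Proof.
move=> kK; suff h (X : {set V}) : X \subset low k ->
    #|X| <= (k - 2) * #|\bigcup_(x in X) nbr F x|.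
  apply: leq_trans (h _ (subxx _)) _; rewrite leq_mul2l; apply/orP; right.
  apply/subset_leq_card/bigcupsP => x; rewrite inE => /andP[_ xk].
  apply/subsetP => y; rewrite !inE => xyF.
  have := low_edge xyF (leq_trans xk kK); move: xk; clear; lia.
have [n] := ubnP #|X|; elim: n => // n IHn in X * => ltn Xlow.
have [->|X0] := eqVneq X set0; first by rewrite cards0.
have [x [y [xX yx alt]]] := no_alternator kK Xlow X0.
have X1 : #|X :&: nbr F y| <= k - 2.
  by rewrite setIC; have := F_deg y; move: alt; clear; lia.
have X1' : 0 < #|X :&: nbr F y|.
  by apply/card_gt0P; exists x; rewrite inE xX nbr_sym.
have IH : #|X :\: nbr F y| <= (k - 2) * #|\bigcup_(z in X :\: nbr F y) nbr F z|.
  apply: IHn (subset_trans (subsetDl _ _) Xlow).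
  by move: ltn X1'; rewrite -(cardsID (nbr F y) X); clear; lia.
rewrite -(cardsID (nbr F y) X); apply: leq_trans (leq_add X1 IH) _.
rewrite -mulnS leq_mul2l; apply/orP; right.
have yN : y \notin \bigcup_(z in X :\: nbr F y) nbr F z.
  by apply/bigcupP => -[z /setDP[_ zy]]; rewrite nbr_sym (negPf zy).
rewrite -add1n -[1]/(true : nat) -yN -cardsU1; apply/subset_leq_card/subsetP => z.
case/setU1P=> [->|/bigcupP[t /setDP[tX _] tz]]; apply/bigcupP; last by exists t.
by exists x.
Qed.

Lemma degree_sum_low : low K != set0 ->
  6 * #|supp F| + (K - 5) * (M + 2 - K) <= \sum_(u in supp F) deg F u.
Proof.
move=> low0; have [x [y [xX yx alt]]] := no_alternator (leqnn K) (subxx _) low0.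
pose Z := nbr F y :\: low K; pose Y := [set u | M + 3 <= deg F u + 5].
have Zs : Z \subset supp F by apply/subsetP => z /setDP[/nbr_supp].
have Ys : Y \subset supp F.
  by apply/subsetP => z; rewrite !inE; move: K_small K_ge6; clear; lia.
have ls k : low k \subset supp F by apply/subsetP => z; rewrite inE => /andP[].
have Zcard : M + 2 - K <= #|Z|.
  rewrite cardsD -/(deg F y); have := subset_leq_card (subsetIl (nbr F y) (low K)).
  by rewrite -/(deg F y); move: alt; clear; lia.
have lowY k : k <= 5 -> #|low k| <= (k - 2) * #|Y|.
  move=> k5; have kK : k <= K := leq_trans k5 (ltnW K_ge6).
  apply: leq_trans (low_card kK) _; rewrite leq_mul2l; apply/orP; right.
  by apply/subset_leq_card/subsetP => z; rewrite !inE => h; move: h k5; clear; lia.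
(* A degree below 6 lacks one unit for each of 3, 4, 5 that it does not exceed. By [lowY] these
   units total at most (1 + 2 + 3)|Y|, covered by the 6 taken from each vertex of Y; the surplus on
   Z remains. *)
have pointwise u : u \in supp F ->
    6 + 6 * (u \in Y : nat) + (K - 5) * (u \in Z : nat) <=
    deg F u + (u \in low 3 : nat) + (u \in low 4 : nat) + (u \in low 5 : nat).
  move=> us; have u3 := supp_deg_ge3 us.
  have zY : (u \in Y : nat) = (M <= deg F u + 2 : nat).
    by rewrite inE; congr (nat_of_bool _); move: (deg F u) => n; clear; lia.
  have zZ : (u \in Z : nat) <= (K < deg F u : nat).
    by rewrite in_setD [u \in low K]inE us -ltnNge; case: (K < _); case: (_ \in _).
  have lowE k : (u \in low k : nat) = (deg F u <= k : nat) by rewrite inE us.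
  rewrite !lowE zY; move: zZ; move: (u \in Z : nat) => zZ.
  move: K_small K_ge6 u3; clear; move: (deg F u) => D h1 h2 h3.
  case: (leqP D 3) => h4; case: (leqP D 4) => h5; case: (leqP D 5) => h6;
    case: (ltnP K D) => h7; case: (leqP M (D + 2)) => h8 /=; nia.
have := leq_sum (index_enum V) pointwise.
rewrite !big_split /= -!big_distrr /= !sum_mem // sum_nat_const.
have := lowY 3 isT; have := lowY 4 isT; have := lowY 5 isT.
move: Zcard; clear; move: #|Z| #|Y| #|low 3| #|low 4| #|low 5| => nz ny l3 l4 l5.
nia.
Qed.

(** All degrees exceed K, so the core has only vertices of degree at least m = max(delta, K + 1) in
    F. There are more than max(A, delta) of them, and the delta neighbours of y even have degree at
    least A. *)
Lemma degree_sum_no_low : low K = set0 ->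
  6 * #|supp F| + (K - 5) * (M + 2 - K) <= \sum_(u in supp F) deg F u.
Proof.
move=> low0.
have sdeg u : u \in supp F -> K < deg F u.
  move=> us; have := in_set0 u; rewrite -low0 inE us /=; move: (deg F u) => n; clear; lia.
have [H [HF H0 core]] := dense_core d_gt0 E0_simple LV_card LE_card FE F_deg F_bad.
have sH := simple_sub HF sF.
have /set0Pn[e eH] := H0; have [a [b [_ eab]]] := sH e eH.
have aH : a \in supp H by apply: (@nbr_supp _ H b); rewrite inE setUC -eab.
case: (@arg_minnP _ a (mem (supp H)) (deg H) aH) => y yH ymin.
set delta := deg H y in ymin; pose m := maxn delta K.+1.
pose A := M + 4 - 2 * d - delta; pose T := [set u in supp F | m <= deg F u].
have delta_gt0 : 0 < delta by have : y \in supp H := yH; rewrite inE.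
have suppHF u : u \in supp H -> u \in supp F.
  by rewrite !inE => h; apply: leq_trans h (deg_sub u HF).
have HT : supp H \subset T.
  apply/subsetP => u uH; rewrite inE suppHF // geq_max sdeg ?suppHF // andbT.
  exact: leq_trans (ymin u uH) (deg_sub u HF).
have nA z : z \in nbr H y -> A <= deg H z.
  by rewrite inE => /core; rewrite -/delta /A; clear; lia.
have /card_gt0P[z zy] := delta_gt0.
have zH := nbr_supp zy.
have cT : (maxn A delta).+1 <= #|T|.
  apply: leq_trans (subset_leq_card HT).
  have : z |: nbr H z \subset supp H.
    by apply/subsetP => t /setU1P[->//|/nbr_supp].
  move/subset_leq_card; apply: leq_trans.
  have -> : #|z |: nbr H z| = (deg H z).+1.
    rewrite cardsU1 (_ : z \notin _) //; apply/negP => zz.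
    by have := nbr_neq sH zz; rewrite eqxx.
  by rewrite ltnS geq_max nA // ymin.
have nT : nbr H y \subset T.
  by apply: subset_trans HT; apply/subsetP => t /nbr_supp.
have Ts : T \subset supp F by apply/subsetP => t; rewrite inE => /andP[].
have ns := subset_trans nT Ts.
have pointwise u : u \in supp F ->
    6 + (m - 6) * (u \in T : nat) + (A - m) * (u \in nbr H y : nat) <= deg F u.
  move=> us; have uK := sdeg u us.
  have [uT|uT] := boolP (u \in T); last first.
    rewrite (negPf (contra (subsetP nT u) uT)); move: uK K_ge6; clear; lia.
  have um : m <= deg F u by move: uT; rewrite inE => /andP[].
  have m6 : 6 <= m by rewrite /m; move: K_ge6; clear; lia.
  have [un|_] := boolP (u \in nbr H y); last by move: um m6; clear; lia.
  by have := leq_trans (nA u un) (deg_sub u HF); move: um m6; clear; lia.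
have := leq_sum (index_enum V) pointwise.
rewrite !big_split /= -!big_distrr /= !sum_mem // sum_nat_const -/(deg H y) -/delta.
have := dense_core_bound d_ge2 K_ge6 K_M delta_gt0; rewrite /= -/m -/A.
have : (m - 6) * (maxn A delta).+1 <= (m - 6) * #|T| by rewrite leq_mul2l cT orbT.
by clear; lia.
Qed.

End CriticalEdgeSet.

Lemma labellable_of_degree_sums (V : finType) (d M K : nat) (E0 : {set {set V}})
    (LV : V -> {fset int}) (LE : {set V} -> {fset int}) :
    2 <= d -> 6 <= K -> 2 * d * K.-1 < M -> simple E0 -> (forall u, deg E0 u <= M) ->
    (forall u, #|` LV u|%fset = M + 2 * d) ->
    {in E0, forall e, #|` LE e|%fset = M + 2 * d} ->
    (forall F : {set {set V}}, F \subset E0 -> F != set0 ->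
      \sum_u deg F u < 6 * #|supp F| + (K - 5) * (M + 2 - K)) ->
  labellable d LV LE E0.
Proof.
move=> d2 K6 KM sE degE LVc LEc sums.
suff h (F : {set {set V}}) : F \subset E0 -> labellable d LV LE F by apply: h.
have [n] := ubnP #|F|; elim: n => // n IHn in F * => ltn FE.
apply: contrapT => Fbad.
have F_min (H : {set {set V}}) : H \proper F -> labellable d LV LE H.
  move=> HF; apply: IHn; last exact: subset_trans (proper_sub HF) FE.
  exact: leq_trans (proper_card HF) ltn.
have F0 : F != set0.
  apply: contra_not_neq Fbad => F0.
  have [|cv cvL _] := @vertex_colouring V d M E0 LV (ltnW d2) sE LVc F FE.
    by move=> u; apply: leq_trans (deg_sub u FE) (degE u).
  by exists cv, (fun=> 0%R); split=> // [u v|e f u|e u|e]; rewrite F0 inE.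
have := sums F FE F0; rewrite ltnNge; case/negP.
have -> : \sum_u deg F u = \sum_(u in supp F) deg F u.
  rewrite [RHS]big_mkcond; apply: eq_bigr => u _; rewrite inE.
  by case: (deg F u).
have [low0|low0] := eqVneq (low F K) set0.
  exact: (degree_sum_no_low d2 K6 KM sE degE LVc LEc FE Fbad low0).
exact: (degree_sum_low d2 K6 KM sE degE LVc LEc FE F_min Fbad low0).
Qed.

(** * Arithmetic of the threshold and conclusion *)

Local Open Scope ring_scope.

(* With s = (M - 1) / (2d), the hypothesis on the maximum degree M says       *)
(* exactly that s >= 5 and (M + 2 - s) (s - 5) >= -6 eps.                     *)
Lemma degree_threshold (R : realType) (d M : nat) (eps : int) : (2 <= d)%N -> eps <= 0 ->
    d%:R / (2 * d%:R - 1) *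
        (10 * d%:R - 8 +
         Num.sqrt ((10 * d%:R - 2) ^+ 2
                   - 24 * (2 * d%:R - 1) * eps%:~R)) + 1
      <= M%:R :> R ->
  10 * d%:Z <= M%:Z - 1 /\
  - 24 * d%:Z ^+ 2 * eps <=
    (2 * d%:Z * (M%:Z + 2) - (M%:Z - 1)) * (M%:Z - 1 - 10 * d%:Z).
Proof.
move=> d2 eps0; set D : R := d%:R; set e : R := eps%:~R; set m : R := M%:R.
set rad := _ - 24 * _ * e.
have D2 : 2 <= D by rewrite /D (ler_nat R 2).
have e0 : e <= 0 by rewrite /e lerz0.
have rad_ge : (10 * D - 2) ^+ 2 <= rad by rewrite /rad; nra.
set Q := Num.sqrt rad => hM.
have Q0 : 0 <= Q := sqrtr_ge0 rad.
have Q2 : Q ^+ 2 = rad by rewrite sqr_sqrtr //; apply: le_trans rad_ge; apply: sqr_ge0.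
have Qge : 10 * D - 2 <= Q.
  rewrite -(@ler_pXn2r _ 2) ?nnegrE ?Q2 //; lra.
have c0 : 0 < 2 * D - 1 by lra.
have hM' : D * (10 * D - 8 + Q) <= (m - 1) * (2 * D - 1).
  rewrite -ler_pdivrMr // -[X in _ <= X](addrK 1) in hM *.
  by rewrite mulrAC; lra.
have m10 : 10 * D <= m - 1 by nra.
have sq : D ^+ 2 * rad <= ((2 * D - 1) * (m - 1) - D * (10 * D - 8)) ^+ 2.
  rewrite -Q2 -exprMn ler_pXn2r // ?nnegrE; nra.
(* Without the term in e, the two sides of [sq] differ by (2D - 1)(m - 1 - 10D)(2D(m + 2) - (m -
   1)), so a factor 2D - 1 cancels. *)
have fin : - 24 * D ^+ 2 * e <= (2 * D * (m + 2) - (m - 1)) * (m - 1 - 10 * D).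
  rewrite -(ler_pM2l c0); move: sq; rewrite /rad; nra.
split.
  by rewrite -(ler_int R) !rmorphB !rmorphM /= !pmulrn in m10 *.
by rewrite -(ler_int R) !(rmorphB, rmorphM, rmorphD, rmorphXn, rmorphN) /=.
Qed.

(** With s = (M - 1) / (2d), passing from s to K changes (x - 5)(M + 2 - x) by (K - s)(M + 7 - K -
    s), which is positive as s < K and K + s < M + 7. *)
Lemma charge_threshold (d M K eps : int) : 2 <= d -> 2 * d * (K - 1) < M -> M <= 2 * d * K ->
    10 * d <= M - 1 ->
    - 24 * d ^+ 2 * eps <= (2 * d * (M + 2) - (M - 1)) * (M - 1 - 10 * d) ->
  - 6 * eps < (K - 5) * (M + 2 - K).
Proof.
move=> d2 KM MK m10 thr; have d0 : 0 < 4 * d ^+ 2 by nia.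
rewrite -(ltr_pM2l d0); pose u := 2 * d * K.
have -> : 4 * d ^+ 2 * ((K - 5) * (M + 2 - K)) =
    (2 * d * (M + 2) - (M - 1)) * (M - 1 - 10 * d) +
    (u - (M - 1)) * (2 * d * (M + 2) + 10 * d - u - (M - 1)) by rewrite /u; ring.
have u1 : 0 < u - (M - 1) by rewrite /u; lia.
have u2 : 0 < 2 * d * (M + 2) + 10 * d - u - (M - 1).
  have : u <= M + 2 * d by rewrite /u; lia.
  by nia.
have := mulr_gt0 u1 u2; move: thr.
have -> : 4 * d ^+ 2 * (- 6 * eps) = - 24 * d ^+ 2 * eps by ring.
by lia.
Qed.

Theorem theorem1p1 (R : realType) (d : nat) (G : sgraph) (S : surface)
    (eps : int)
    (hd : (2 <= d)%N)
    (hG : embedded_in G S)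
    (hS : euler_char S = eps)
    (heps : eps <= 0)
    (hDelta :
      d%:R / (2 * d%:R - 1) *
        (10 * d%:R - 8 +
         Num.sqrt ((10 * d%:R - 2) ^+ 2
                   - 24 * (2 * d%:R - 1) * eps%:~R)) + 1
      <= (max_degree G)%:R :> R) :
  (total_choosability d G <= max_degree G + 2 * d)%N.
Proof.
set M := max_degree G in hDelta *.
have [m10 thr] := degree_threshold hd heps hDelta.
rewrite /total_choosability; case: ex_minnP => k _; apply; apply/asboolP => L Lk.
(* The largest K with 2dK < M + 2d. *)
pose K := ((M - 1) %/ (2 * d)).+1.
have KM : (2 * d * K.-1 < M)%N.
  by rewrite /K /= mulnC; have := leq_divM (M - 1) (2 * d); lia.
have MK : (M <= 2 * d * K)%N.
  by rewrite /K mulnC; have := ltn_ceil (M - 1) (_ : 0 < 2 * d)%N; lia.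
have K6 : (6 <= K)%N by nia.
(* Off the edges of G the empty list is harmless: only lists of edges are constrained. *)
pose LE e := if insub e is Some f then L (inr f) else fset0.
have [phi phiP] := hG.
have degE u : (deg (edge_set G) u <= M)%N.
  apply: leq_trans (leq_bigmax u); apply/subset_leq_card/subsetP => v.
  by rewrite !inE => /adj_edge_set.
have [|e eE|F FE F0|cv [ce [cvP ceP cvceP cvL ceL]]] :=
    @labellable_of_degree_sums G d M K (edge_set G) (fun u => L (inl u)) LE
      hd K6 KM (@edge_set_simple G) degE.
- by move=> u; apply: Lk.
- by rewrite /LE insubT Lk.
- have := degree_sum phiP FE F0; rewrite hS => /(_ heps).
  have KM2 : (K <= M)%N by move: KM hd; rewrite /K /=; clear; nia.
  have := @charge_threshold d%:Z M%:Z K%:Z eps _ _ _ m10 thr.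
  have -> : (K%:Z - 5) * (M%:Z + 2 - K%:Z) = ((K - 5) * (M + 2 - K))%N%:Z.
    by rewrite PoszM; congr (_ * _); move: K6 KM2; clear; lia.
  have KMz : 2 * d%:Z * (K%:Z - 1) < M%:Z.
    by rewrite (_ : K%:Z - 1 = K.-1%:Z) -?PoszM ?ltz_nat //; move: K6; clear; lia.
  have MKz : M%:Z <= 2 * d%:Z * K%:Z by rewrite -!PoszM lez_nat.
  move=> /(_ hd KMz MKz); clear; lia.
exists (fun x => match x with inl u => cv u | inr e => ce (val e) end); split.
  split=> [u v uv|e f w ef we wf|u e ue].
  - by apply/eqP/cvP; apply/imsetP; exists (u, v); rewrite ?inE.
  - apply/eqP/(ceP _ _ w) => //; try exact: valP.
    by apply: contra_not_neq ef => /val_inj.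
  - by apply: cvceP => //; apply: valP.
case=> [u|e]; first exact: cvL.
by have := ceL _ (valP e); rewrite /LE valK.
Qed.
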